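(* Let $V$ be a complex vector space of finite dimension $N$ with basis $\{x_i\}_{1\le i\le N}$, let $q\in\mathbb{C}\setminus\{0,1,-1\}$, and let $R:V^{\otimes 2}\to V^{\otimes 2}$, $R(x_i\otimes x_j)=R_{ij}^{kl}\,x_k\otimes x_l$, be a skew-invertible Hecke symmetry, with skew-inverse $\Psi$ and $B_i^j=\Psi_{ki}^{kj}$. Let $\{x^i\}$ be the right dual basis of $V^*$. Then the defining relations of the algebras $$\mathrm{Sym}_R(V)=T(V)/\langle q\,x_ix_j-R_{ij}^{kl}x_kx_l\rangle,\qquad \mathrm{Sym}_R(V^* )=T(V^* )/\langle q\,x^jx^i-R_{kl}^{ij}x^lx^k\rangle$$ are compatible with the permutation relations $$x^aR_{ai}^{bj}x_b=q^{-1}x_ix^j+\delta_i^j\qquad\Longleftrightarrow\qquad x^lx_k=q^{-1}x_ix^j\,\Psi_{jk}^{il}+B_k^l .$$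
   Context: Summation over repeated indices is understood and the sign $\otimes$ is omitted in products. All algebras are associative and unital over $\mathbb{C}$. **Hecke symmetry.** A braiding is an operator $R:V^{\otimes 2}\to V^{\otimes 2}$ with $R_{12}R_{23}R_{12}=R_{23}R_{12}R_{23}$ on $V^{\otimes 3}$, where $R_{12}=R\otimes I$, $R_{23}=I\otimes R$. It is a Hecke symmetry if in addition $(R-qI)(R+q^{-1}I)=0$. **Skew-invertibility.** $R$ is skew-invertible if there is an operator $\Psi$ on $V^{\otimes 2}$, with matrix $\Psi_{ij}^{kl}$, such that $R_{ij}^{kl}\Psi_{lm}^{jn}=\delta_m^k\delta_i^n$. **Right dual basis.** $\{x^i\}$ is the basis of $V^*$ with $\langle x_i,x^j\rangle_r=\delta_i^j$ for a fixed nondegenerate pairing $V\otimes V^*\to\mathbb{C}$. **Algebras.** $T(V)$ and $T(V^* )$ are the tensor algebras, and $\langle J\rangle$ is the two-sided ideal generated by $J$ (here all listed relations, $1\le i,j\le N$). **Compatibility.** Put $A=\mathrm{Sym}_R(V^* )$, $B=\mathrm{Sym}_R(V)$ (the algebra $B$ is not to be confused with the matrix $B_i^j$). The permutation relations define a linear map $\sigma$ on generators, $$\sigma(x^l\otimes x_k)=q^{-1}\Psi_{jk}^{il}\,x_i\otimes x^j+B_k^l\,1\otimes 1.$$ It extends uniquely to a linear map $\sigma:T(V^* )\otimes T(V)\to T(V)\otimes T(V^* )$ satisfying - $\sigma\circ(\mu_A\otimes\mathrm{id})=(\mathrm{id}\otimes\mu_A)\circ\sigma_{12}\sigma_{23}$,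 - $\sigma\circ(\mathrm{id}\otimes\mu_B)=(\mu_B\otimes\mathrm{id})\circ\sigma_{23}\sigma_{12}$, - $\sigma(1\otimes b)=b\otimes 1$ and $\sigma(a\otimes 1)=1\otimes a$, where $\mu_A,\mu_B$ denote the multiplications (here, of $T(V^* )$ and $T(V)$). The defining relations of $A$ and $B$ are called compatible with the permutation relations if the permutation map preserves these relations, i.e. $\sigma$ descends to a well-defined linear map $\sigma:A\otimes B\to B\otimes A$ (which then satisfies the same three conditions, making $(A,B)$ a double of associative algebras). *)

(* Defs.v *)
From HB Require Import structures.
From mathcomp Require Import all_boot all_order all_algebra.
From mathcomp Require Import boolp reals.
From mathcomp Require Import complex.
From mathcomp Require Import finmap monalg.

Set Implicit Arguments.
Unset Strict Implicit.
Unset Printing Implicit Defensive.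

Import GRing.Theory.
Local Open Scope ring_scope.
Local Open Scope quotient_scope.

Section Span.
Variables (K : fieldType) (U : lmodType K).

Definition subspace (S : U -> Prop) : Prop :=
  S 0 /\ forall (a : K) (u v : U), S u -> S v -> S (a *: u + v).

Definition span_of (J : U -> Prop) : {pred U} := fun u =>
  `[< forall S : U -> Prop, subspace S -> (forall x, J x -> S x) -> S u >].

Lemma span_ofP (J : U -> Prop) u :
  reflect (forall S : U -> Prop, subspace S -> (forall x, J x -> S x) -> S u)
          (u \in span_of J).
Proof. exact: asboolP. Qed.

Fact span_of_submod_closed J : submod_closed (span_of J).
Proof.
split; first by apply/span_ofP => S [].
move=> a u v /span_ofP Su /span_ofP Sv; apply/span_ofP => S hS hJ.
by case: (hS) => _; apply; [apply: Su | apply: Sv].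
Qed.
HB.instance Definition _ J :=
  GRing.isSubmodClosed.Build K U (span_of J) (span_of_submod_closed J).

End Span.

Section RawQuotient.
Variables (K : fieldType) (U : lmodType K) (J : U -> Prop).

Definition rawq : Type := Quotient.quot (span_of J : zmodClosed U).
HB.instance Definition _ := EqQuotient.on rawq.
HB.instance Definition _ := GRing.Zmodule.on rawq.

Definition rawpi (u : U) : rawq := \pi u.

Fact rawpiK (t : rawq) : rawpi (repr t) = t.
Proof. exact: reprK. Qed.

Fact rawpi_eq (u v : U) : (rawpi u = rawpi v) <-> (u - v \in span_of J).
Proof.
rewrite /rawpi (Quotient.idealrBE (span_of J)).
by split => [->|/eqP].
Qed.

Fact rawpiD u v : rawpi (u + v) = rawpi u + rawpi v.
Proof. exact: (Quotient.pi_add (span_of J)). Qed.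

Definition scaleq (a : K) (t : rawq) : rawq := rawpi (a *: repr t).

Fact scaleq_pi a u : scaleq a (rawpi u) = rawpi (a *: u).
Proof.
by apply/rawpi_eq; rewrite -scalerBr rpredZ //; apply/rawpi_eq; exact: rawpiK.
Qed.

Fact scaleqA a b t : scaleq a (scaleq b t) = scaleq (a * b) t.
Proof. by rewrite -(rawpiK t) !scaleq_pi scalerA. Qed.
Fact scaleq1 : left_id 1 scaleq.
Proof. by move=> t; rewrite -(rawpiK t) scaleq_pi scale1r. Qed.
Fact scaleqDr : right_distributive scaleq +%R.
Proof.
move=> a t s; rewrite -(rawpiK t) -(rawpiK s).
by rewrite -rawpiD !scaleq_pi -rawpiD scalerDr.
Qed.
Fact scaleqDl t : {morph scaleq^~ t : a b / a + b}.
Proof. by move=> a b; rewrite -(rawpiK t) !scaleq_pi -rawpiD scalerDl. Qed.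
HB.instance Definition _ :=
  GRing.Zmodule_isLmodule.Build K rawq scaleqA scaleq1 scaleqDr scaleqDl.

Record quot_pack := QuotPack {
  quot_sort : lmodType K;
  quot_pi : U -> quot_sort;
  quot_repr : quot_sort -> U }.

End RawQuotient.

(* The quotient U / span J with its projection and a section of it, packed so
   that it can be locked: otherwise failing unifications unfold it. *)
HB.lock Definition quot_of (K : fieldType) (U : lmodType K) (J : U -> Prop)
  : quot_pack U := @QuotPack K U (rawq J : lmodType K) (@rawpi K U J) repr.

Section QuotientModule.
Variables (K : fieldType) (U : lmodType K) (J : U -> Prop).

Definition quotm : lmodType K := quot_sort (quot_of J).
Definition projm : U -> quotm := @quot_pi K U (quot_of J).
Definition reprm : quotm -> U := @quot_repr K U (quot_of J).

Lemma projm_surj (t : quotm) : projm (reprm t) = t.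
Proof.
by move: t; rewrite /projm /reprm /quotm quot_of.unlock; exact: rawpiK.
Qed.

Lemma projm_eq (u v : U) : (projm u = projm v) <-> (u - v \in span_of J).
Proof. by rewrite /projm /quotm quot_of.unlock; exact: rawpi_eq. Qed.

Fact projm_is_linear : linear projm.
Proof.
rewrite /projm /quotm quot_of.unlock => a u v /=.
by rewrite rawpiD -scaleq_pi.
Qed.
HB.instance Definition _ :=
  GRing.isLinear.Build K U quotm *:%R projm projm_is_linear.

End QuotientModule.

Section Tensor.
Variables (K : fieldType) (U W : lmodType K).

(* U (x) W is the free vector space on U * W modulo the bilinearity relations;
   it is needed for infinite-dimensional U and W. *)
Definition free2 : Type := {malg K[(U * W)%type]}.
HB.instance Definition _ := GRing.Lmodule.on free2.
Definition gen2 (u : U) (w : W) : free2 := mkmalgU (u, w) 1.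

Inductive bilin_rel : free2 -> Prop :=
| BilinL a u u' w :
    bilin_rel (gen2 (a *: u + u') w - (a *: gen2 u w + gen2 u' w))
| BilinR a u w w' :
    bilin_rel (gen2 u (a *: w + w') - (a *: gen2 u w + gen2 u w')).

Definition tens : lmodType K := quotm bilin_rel.

End Tensor.

HB.lock Definition tpure (K : fieldType) (U W : lmodType K) (u : U) (w : W)
  : tens U W := projm (@bilin_rel K U W) (gen2 u w).

Notation "u ⊗ w" := (tpure u w)
  (at level 40, left associativity) : ring_scope.

Record bilin (K : fieldType) (U W X : lmodType K) (f : U -> W -> X) : Prop :=
  Bilin {
    bilinL : forall w, linear (f^~ w);
    bilinR : forall u, linear (f u) }.

(* The value on t is computed on a representative in the free vector space;
   it does not depend on that representative. *)
HB.lock Definition tlift (K : fieldType) (U W X : lmodType K)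
  (f : U -> W -> X) (bf : bilin f) (t : tens U W) : X :=
  let g : {malg K[(U * W)%type]} := reprm t in
  \sum_(p <- msupp g) g@_p *: f p.1 p.2.

Section TensorLift.
Variables (K : fieldType) (U W X : lmodType K).

Section Lift.
Variables (f : U -> W -> X) (bf : bilin f).

Let ev (g : free2 U W) : X :=
  \sum_(p <- msupp g) (g : {malg K[(U * W)%type]})@_p *: f p.1 p.2.

Let evw (d : {fset (U * W)%type}) (g : free2 U W) :
  (msupp g `<=` d)%fset -> ev g = \sum_(p <- d) g@_p *: f p.1 p.2.
Proof.
move=> le; rewrite [LHS](big_fset_incl _ le) => //= p pd /mcoeff_outdom ->.
by rewrite scale0r.
Qed.

Let ev_linear : linear ev.
Proof.
move=> a g1 g2; set d := (msupp g1 `|` msupp g2)%fset.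
have s1 : (msupp g1 `<=` d)%fset by exact: fsubsetUl.
have s2 : (msupp g2 `<=` d)%fset by exact: fsubsetUr.
have s3 : (msupp (a *: g1 + g2) `<=` d)%fset.
  apply: fsubset_trans (msuppD_le _ _) _; apply: fsetSU; exact: msuppZ_le.
rewrite (evw s1) (evw s2) (evw s3) scaler_sumr -big_split /=.
by apply: eq_bigr => p _; rewrite mcoeffD mcoeffZ scalerDl scalerA.
Qed.

Let ev_gen u w : ev (gen2 u w) = f u w.
Proof.
by rewrite (evw msuppU_le) big_seq_fset1 mcoeffUU scale1r.
Qed.

Let ev_rel g : g \in span_of (@bilin_rel K U W) -> ev g = 0.
Proof.
pose L := GRing.isLinear.Build K (free2 U W) X *:%R ev ev_linear.
pose evl : {linear free2 U W -> X} := HB.pack ev L.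
move/span_ofP/(_ (fun g => ev g = 0)); apply.
  split; first exact: (linear0 evl).
  by move=> a u v hu hv; rewrite ev_linear hu hv scaler0 addr0.
move=> _ [a u u' w|a u w w'].
  rewrite -[ev _]/(evl _) raddfB /= ev_linear !ev_gen.
  by rewrite (bilinL bf w a u u') subrr.
rewrite -[ev _]/(evl _) raddfB /= ev_linear !ev_gen.
by rewrite (bilinR bf u a w w') subrr.
Qed.

Let ev_repr g : tlift bf (projm (@bilin_rel K U W) g) = ev g.
Proof.
pose L := GRing.isLinear.Build K (free2 U W) X *:%R ev ev_linear.
pose evl : {linear free2 U W -> X} := HB.pack ev L.
apply/subr0_eq; rewrite tlift.unlock -[X in X - _]/(evl _) -[X in _ - X]/(evl _).
by rewrite -raddfB /= ev_rel //; apply/projm_eq; exact: projm_surj.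
Qed.

Fact tlift_is_linear : linear (tlift bf).
Proof.
move=> a t s; rewrite -(projm_surj t) -(projm_surj s) -linearP.
by rewrite !ev_repr ev_linear.
Qed.
HB.instance Definition _ :=
  GRing.isLinear.Build K (tens U W) X *:%R (tlift bf) tlift_is_linear.

Lemma tliftE u w : tlift bf (u ⊗ w) = f u w.
Proof. by rewrite tpure.unlock ev_repr ev_gen. Qed.

End Lift.

Lemma tpure_linearl (w : W) : linear (fun u : U => u ⊗ w).
Proof.
move=> a u u'; rewrite tpure.unlock -linearP; apply/projm_eq.
by apply/span_ofP => S _; apply; exact: BilinL.
Qed.

Lemma tpure_linearr (u : U) : linear (fun w : W => u ⊗ w).
Proof.
move=> a w w'; rewrite tpure.unlock -linearP; apply/projm_eq.
by apply/span_ofP => S _; apply; exact: BilinR.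
Qed.

Lemma tens_ind (P : tens U W -> Prop) :
  P 0 -> (forall a u w t, P t -> P (a *: (u ⊗ w) + t)) -> forall t, P t.
Proof.
move=> P0 PS t; rewrite -(projm_surj t).
have H (s : seq (U * W)) (c : U * W -> K) :
    P (projm (@bilin_rel K U W) (\sum_(p <- s) c p *: gen2 p.1 p.2)).
  elim: s => [|[u w] s IH]; first by rewrite big_nil linear0.
  rewrite big_cons linearP; have := PS (c (u, w)) u w _ IH.
  by rewrite tpure.unlock.
have -> : reprm t = \sum_(p <- msupp (reprm t : {malg K[(U * W)%type]}))
    (reprm t : {malg K[(U * W)%type]})@_p *: gen2 p.1 p.2.
  rewrite {1}[reprm t](monalgE (reprm t : {malg K[(U * W)%type]})).
  apply: eq_bigr => -[u w] _; apply/malgP => k /=.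
  by rewrite mcoeffZ /gen2 !mcoeffU mulrnAr mulr1.
apply: (H _ (fun p => (reprm t : {malg K[(U * W)%type]})@_p)).
Qed.

End TensorLift.

Section TensorMaps.
Variables (K : fieldType) (U V W U' W' : lmodType K).

Fact tmap_bilin (f : {linear U -> U'}) (g : {linear W -> W'}) :
  bilin (fun u w => f u ⊗ g w).
Proof.
split=> [w|u] a x y; rewrite linearP; first exact: tpure_linearl.
exact: tpure_linearr.
Qed.

Fact tassoc1_bilin (w : W) : bilin (fun (u : U) (v : V) => u ⊗ (v ⊗ w)).
Proof.
split=> [v|u] a x y; first exact: tpure_linearl.
by rewrite tpure_linearl tpure_linearr.
Qed.

Fact tassoc_bilin :
  bilin (fun (t : tens U V) (w : W) => tlift (tassoc1_bilin w) t).
Proof.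
split=> [w|t] a x y; first exact: linearP.
elim/tens_ind: t => [|b u v t IH]; first by rewrite !linear0 addr0.
rewrite !linearP /= !tliftE IH !tpure_linearr !scalerDr !scalerA mulrC.
by rewrite addrACA.
Qed.

Fact tassocV1_bilin (u : U) : bilin (fun (v : V) (w : W) => u ⊗ v ⊗ w).
Proof.
split=> [w|v] a x y; last exact: tpure_linearr.
by rewrite tpure_linearr tpure_linearl.
Qed.

Fact tassocV_bilin :
  bilin (fun (u : U) (t : tens V W) => tlift (tassocV1_bilin u) t).
Proof.
split=> [t|u] a x y; last exact: linearP.
elim/tens_ind: t => [|b v w t IH]; first by rewrite !linear0 addr0.
rewrite !linearP /= !tliftE IH !tpure_linearl !scalerDr !scalerA mulrC.
by rewrite addrACA.
Qed.

Fact tmul_bilin (A : algType K) : bilin (fun a b : A => a * b).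
Proof.
split=> [b|a] c x y; first by rewrite mulrDl scalerAl.
by rewrite mulrDr scalerAr.
Qed.

End TensorMaps.

HB.lock Definition tmap (K : fieldType) (U U' W W' : lmodType K)
  (f : {linear U -> U'}) (g : {linear W -> W'}) : tens U W -> tens U' W' :=
  tlift (tmap_bilin f g).
HB.lock Definition tassoc (K : fieldType) (U V W : lmodType K)
  : tens (tens U V) W -> tens U (tens V W) := tlift (@tassoc_bilin K U V W).
HB.lock Definition tassocV (K : fieldType) (U V W : lmodType K)
  : tens U (tens V W) -> tens (tens U V) W := tlift (@tassocV_bilin K U V W).
HB.lock Definition tmul (K : fieldType) (A : algType K) : tens A A -> A :=
  tlift (@tmul_bilin K A).

Arguments tassoc {K U V W} _.
Arguments tassocV {K U V W} _.
Arguments tmul {K} A _.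

Section TensorMapsTheory.
Variables (K : fieldType) (U V W U' W' : lmodType K) (A : algType K).
Variables (f : {linear U -> U'}) (g : {linear W -> W'}).

Fact tmap_is_linear : linear (tmap f g).
Proof. rewrite tmap.unlock; exact: linearP. Qed.
HB.instance Definition _ :=
  GRing.isLinear.Build K (tens U W) (tens U' W') *:%R (tmap f g) tmap_is_linear.

Fact tassoc_is_linear : linear (@tassoc K U V W).
Proof. rewrite tassoc.unlock; exact: linearP. Qed.
HB.instance Definition _ :=
  GRing.isLinear.Build K (tens (tens U V) W) (tens U (tens V W)) *:%R
    (@tassoc K U V W) tassoc_is_linear.

Fact tassocV_is_linear : linear (@tassocV K U V W).
Proof. rewrite tassocV.unlock; exact: linearP. Qed.
HB.instance Definition _ :=
  GRing.isLinear.Build K (tens U (tens V W)) (tens (tens U V) W) *:%R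
    (@tassocV K U V W) tassocV_is_linear.

Fact tmul_is_linear : linear (@tmul K A).
Proof. rewrite tmul.unlock; exact: linearP. Qed.
HB.instance Definition _ :=
  GRing.isLinear.Build K (tens A A) A *:%R (@tmul K A) tmul_is_linear.

Lemma tmapE u w : tmap f g (u ⊗ w) = f u ⊗ g w.
Proof. by rewrite tmap.unlock tliftE. Qed.

Lemma tassocE (u : U) (v : V) (w : W) : tassoc (u ⊗ v ⊗ w) = u ⊗ (v ⊗ w).
Proof. by rewrite tassoc.unlock !tliftE. Qed.

Lemma tassocVE (u : U) (v : V) (w : W) : tassocV (u ⊗ (v ⊗ w)) = u ⊗ v ⊗ w.
Proof. by rewrite tassocV.unlock !tliftE. Qed.

Lemma tmulE (a b : A) : tmul A (a ⊗ b) = a * b.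
Proof. by rewrite tmul.unlock tliftE. Qed.

End TensorMapsTheory.

Section TwoSidedIdeal.
Variables (K : fieldType) (A : algType K) (J : A -> Prop).

Definition sandwich (x : A) : Prop :=
  exists a j b : A, J j /\ x = a * j * b.

(* A / <J>: as a vector space, the two-sided ideal <J> is spanned by the
   products a * j * b with j in J. *)
Definition qalg : Type := quotm sandwich.
HB.instance Definition _ := GRing.Lmodule.on qalg.
Definition qproj : {linear A -> qalg} := projm sandwich.

End TwoSidedIdeal.

HB.lock Definition mulq (K : fieldType) (A : algType K) (J : A -> Prop)
  (s t : qalg J) : qalg J := qproj J (reprm s * reprm t).

Section QuotientAlgebra.
Variables (K : fieldType) (A : algType K) (J : A -> Prop).
Local Notation sandwich := (sandwich J).
Local Notation qalg := (qalg J).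
Local Notation qproj := (qproj J).
Local Notation mulq := (@mulq K A J).

Lemma ideal_mulr (c x : A) :
  x \in span_of sandwich -> c * x \in span_of sandwich.
Proof.
move/span_ofP => Jx; apply/span_ofP => S [S0 SD] JS.
apply: (Jx (fun x => S (c * x))) => [|_ [a [j [b [Jj ->]]]]].
  split=> [|a u v Su Sv]; first by rewrite mulr0.
  by rewrite mulrDr -scalerAr; apply: SD.
by apply: JS; exists (c * a), j, b; rewrite !mulrA.
Qed.

Lemma ideal_mull (c x : A) :
  x \in span_of sandwich -> x * c \in span_of sandwich.
Proof.
move/span_ofP => Jx; apply/span_ofP => S [S0 SD] JS.
apply: (Jx (fun x => S (x * c))) => [|_ [a [j [b [Jj ->]]]]].
  split=> [|a u v Su Sv]; first by rewrite mul0r.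
  by rewrite mulrDl -scalerAl; apply: SD.
by apply: JS; exists a, j, (b * c); rewrite !mulrA.
Qed.

Lemma qproj_surj (t : qalg) : qproj (reprm t) = t.
Proof. exact: projm_surj. Qed.

Lemma mulq_proj x y : mulq (qproj x) (qproj y) = qproj (x * y).
Proof.
have E z : reprm (qproj z) - z \in span_of sandwich.
  by apply/projm_eq; exact: projm_surj.
rewrite mulq.unlock; apply/projm_eq.
have -> : reprm (qproj x) * reprm (qproj y) - x * y =
    (reprm (qproj x) - x) * reprm (qproj y) + x * (reprm (qproj y) - y).
  by rewrite mulrBl mulrBr addrA subrK.
by apply: rpredD; [exact: ideal_mull | exact: ideal_mulr].
Qed.

Fact mulqA : associative mulq.
Proof.
move=> s t u; rewrite -(qproj_surj s) -(qproj_surj t) -(qproj_surj u).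
by rewrite !mulq_proj mulrA.
Qed.
Fact mul1q : left_id (qproj 1) mulq.
Proof. by move=> s; rewrite -(qproj_surj s) mulq_proj mul1r. Qed.
Fact mulq1 : right_id (qproj 1) mulq.
Proof. by move=> s; rewrite -(qproj_surj s) mulq_proj mulr1. Qed.
Fact mulqDl : left_distributive mulq +%R.
Proof.
move=> s t u; rewrite -(qproj_surj s) -(qproj_surj t) -(qproj_surj u).
by rewrite -linearD !mulq_proj -linearD mulrDl.
Qed.
Fact mulqDr : right_distributive mulq +%R.
Proof.
move=> s t u; rewrite -(qproj_surj s) -(qproj_surj t) -(qproj_surj u).
by rewrite -linearD !mulq_proj -linearD mulrDr.
Qed.
HB.instance Definition _ :=
  GRing.Zmodule_isPzRing.Build qalg mulqA mul1q mulq1 mulqDl mulqDr.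

Lemma qprojM x y : qproj (x * y) = qproj x * qproj y.
Proof. by rewrite -mulq_proj. Qed.

Fact qalg_scaleAl (a : K) (s t : qalg) : a *: (s * t) = (a *: s) * t.
Proof.
rewrite -(qproj_surj s) -(qproj_surj t) -linearZ -!qprojM -linearZ.
by rewrite scalerAl.
Qed.
Fact qalg_scaleAr (a : K) (s t : qalg) : a *: (s * t) = s * (a *: t).
Proof.
rewrite -(qproj_surj s) -(qproj_surj t) -linearZ -!qprojM -linearZ.
by rewrite scalerAr.
Qed.

End QuotientAlgebra.

Section TensorAlgebra.
Variables (K : fieldType) (V : lmodType K).

(* The free algebra on the underlying set of V. *)
Definition falg : Type := {malg K[{fmonom V}]}.
HB.instance Definition _ := GRing.Lalgebra.on falg.

Fact falg_scaleAr (a : K) (x y : falg) : a *: (x * y) = x * (a *: y).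
Proof.
have xa : (x : {malg K[{fmonom V}]}) * a%:MP = a%:MP * x.
  rewrite malgM_def mul_malgC malgZ_def /fgscale fgmulgU.
  by apply: eq_bigr => k _; rewrite mulm1 mulrC.
by rewrite -[RHS]/(x * (a *: y)) -!mul_malgC mulrA -xa mulrA.
Qed.
HB.instance Definition _ := GRing.Lalgebra_isAlgebra.Build K falg falg_scaleAr.

Definition letter (v : V) : falg := mkmalgU (fmu v) 1.

Definition letter_rel (t : falg) : Prop :=
  exists a u v, t = letter (a *: u + v) - (a *: letter u + letter v).

(* T(V): the free algebra on the set V, in which the letters are made linear. *)
Definition talg_sort : Type := qalg letter_rel.
HB.instance Definition _ := GRing.Lmodule.on talg_sort.
HB.instance Definition _ := GRing.PzRing.on talg_sort.

Fact talg_oner_neq0 : (1 : talg_sort) != 0.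
Proof.
apply/eqP => h10.
have /projm_eq : qproj letter_rel 1 = qproj letter_rel 0.
  by rewrite linear0 -h10.
rewrite subr0 => /span_ofP H.
have {H} : (1 : {malg K[{fmonom V}]})@_mone = 0.
  apply: (H (fun t => (t : {malg K[{fmonom V}]})@_mone = 0)).
    split=> [|a u v hu hv]; first exact: mcoeff0.
    by rewrite mcoeffD mcoeffZ hu hv mulr0 addr0.
  have L v : (letter v : {malg K[{fmonom V}]})@_mone = 0.
    by rewrite mcoeffU fm1_eq1.
  move=> _ [a [_ [b [[c [u [v ->]]] ->]]]].
  rewrite (rmorphM (mcoeff mone)) (rmorphM (mcoeff mone)) /=.
  by rewrite mcoeffB mcoeffD mcoeffZ !L mulr0 addr0 subr0 mulr0 mul0r.
by move/eqP; rewrite mcoeff1 eqxx oner_eq0.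
Qed.
HB.instance Definition _ :=
  GRing.PzSemiRing_isNonZero.Build talg_sort talg_oner_neq0.
HB.instance Definition _ :=
  GRing.Lmodule_isLalgebra.Build K talg_sort (@qalg_scaleAl K falg letter_rel).
HB.instance Definition _ :=
  GRing.Lalgebra_isAlgebra.Build K talg_sort (@qalg_scaleAr K falg letter_rel).

End TensorAlgebra.

(* T(V) together with V -> T(V), packed so that the pair can be locked. *)
HB.lock Definition talg_data (K : fieldType) (V : lmodType K)
  : {T : algType K & V -> T} :=
  existT (fun T : algType K => V -> T) (talg_sort V : algType K)
    (fun v => qproj (@letter_rel K V) (letter v)).

Definition talg (K : fieldType) (V : lmodType K) : algType K :=
  projT1 (talg_data V).
Definition tvar (K : fieldType) (V : lmodType K) : V -> talg V :=
  projT2 (talg_data V).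

Section TensorAlgebraTheory.
Variables (K : fieldType) (V : lmodType K).

Fact tvar_is_linear : linear (@tvar K V).
Proof.
rewrite /tvar /talg talg_data.unlock /=.
move=> a u v; rewrite -[X in _ = X](linearP (qproj (@letter_rel K V))).
apply/projm_eq; apply/span_ofP => S _; apply.
exists 1, (letter (a *: u + v) - (a *: letter u + letter v)), 1.
by rewrite mul1r mulr1; split=> //; exists a, u, v.
Qed.
HB.instance Definition _ :=
  GRing.isLinear.Build K V (talg V) *:%R (@tvar K V) tvar_is_linear.

Lemma talg_ind (P : talg V -> Prop) :
  P 1 -> (forall a s t, P s -> P t -> P (a *: s + t)) ->
  (forall v t, P t -> P (tvar v * t)) -> forall t, P t.
Proof.
move: P; rewrite /tvar /talg talg_data.unlock /= => P P1 PD PM t.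
have P0 : P 0 by have := PD (-1) _ _ P1 P1; rewrite scaleN1r addNr.
rewrite -(qproj_surj t); set g : {malg K[{fmonom V}]} := reprm t.
have W (m : {fmonom V}) : P (qproj (@letter_rel K V) (mkmalgU m 1)).
  rewrite -[m]fmK; elim: (fmonom_val m) => [|v w IH].
    by move: P1; congr P; congr (qproj _ _); rewrite -fmoneE.
  have -> : (mkmalgU (FMonom (v :: w)) 1 : falg V) =
      letter v * (mkmalgU (FMonom w) 1 : falg V).
    rewrite [RHS]malgM_def fgmulUU mulr1; congr (mkmalgU _ _).
    by apply/eqP; rewrite fmP fmM fmU.
  by rewrite qprojM; apply: PM.
have H (s : seq {fmonom V}) (c : {fmonom V} -> K) :
    P (qproj (@letter_rel K V) (\sum_(m <- s) c m *: (mkmalgU m 1 : falg V))).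
  elim: s => [|m s IH]; first by rewrite big_nil linear0.
  by rewrite big_cons linearP; apply: PD.
have -> : (g : falg V) =
    \sum_(m <- msupp g) g@_m *: (mkmalgU m 1 : falg V).
  rewrite [LHS](monalgE g); apply: eq_bigr => m _; apply/malgP => k.
  by rewrite mcoeffZ !mcoeffU mulrnAr mulr1.
exact: H.
Qed.

End TensorAlgebraTheory.

HB.lock Definition vdual (K : fieldType) (V : vectType K) : vectType K :=
  'Hom(V, K^o).

Section HeckeSymmetry.
Variables (K : fieldType) (V : vectType K).
Implicit Types f : {linear tens V V -> tens V V}.

(* V^{⊗3} is (V ⊗ V) ⊗ V, so R_23 is conjugated by the associator. *)
Definition op12 f : {linear tens (tens V V) V -> tens (tens V V) V} :=
  tmap f idfun.
Definition op23 f (t : tens (tens V V) V) : tens (tens V V) V :=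
  tassocV (tmap idfun f (tassoc t)).

Definition braiding f : Prop :=
  forall t, op12 f (op23 f (op12 f t)) = op23 f (op12 f (op23 f t)).

Definition hecke_symmetry (q : K) f : Prop :=
  braiding f /\
  forall t, let s := f t + q^-1 *: t in f s - q *: s = 0.

(* For M : coefs N, the entry M_{ij}^{kl} is M i j k l. *)
Definition coefs (N : nat) := 'I_N -> 'I_N -> 'I_N -> 'I_N -> K.

(* f(x_i ⊗ x_j) = M_{ij}^{kl} x_k ⊗ x_l *)
Definition has_matrix (N : nat) (x : N.-tuple V) f (M : coefs N) : Prop :=
  forall i j, f (tnth x i ⊗ tnth x j) =
    \sum_k \sum_l M i j k l *: (tnth x k ⊗ tnth x l).

(* M_{ij}^{kl} P_{lm}^{jn} = delta_m^k delta_i^n, summed over j and l. *)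
Definition skew_inverse (N : nat) (M P : coefs N) : Prop :=
  forall i k m n : 'I_N,
    \sum_j \sum_l M i j k l * P l m j n = (m == k)%:R * (i == n)%:R.

(* B_i^j = P_{ki}^{kj}, summed over k. *)
Definition Bmat (N : nat) (P : coefs N) (i j : 'I_N) : K := \sum_k P k i k j.

Definition nondegenerate_pairing (p : {linear tens V (vdual V) -> K^o}) : Prop :=
  (forall v, (forall g, p (v ⊗ g) = 0) -> v = 0) /\
  (forall g, (forall v, p (v ⊗ g) = 0) -> g = 0).

Definition right_dual_basis (N : nat) (p : {linear tens V (vdual V) -> K^o})
    (x : N.-tuple V) (xd : N.-tuple (vdual V)) : Prop :=
  basis_of fullv xd /\ forall i j, p (tnth x i ⊗ tnth xd j) = (i == j)%:R.

End HeckeSymmetry.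

Section PermutationRelations.
Variables (K : fieldType) (V : vectType K) (N : nat) (q : K).
Variables (x : N.-tuple V) (xd : N.-tuple (vdual V)) (M P : coefs K N).

Local Notation TV := (talg V).
Local Notation TVd := (talg (vdual V)).
Local Notation gx i := (tvar (tnth x i) : TV).
Local Notation gxd i := (tvar (tnth xd i) : TVd).

Definition symR_rel (t : TV) : Prop := exists i j,
  t = q *: (gx i * gx j) - \sum_k \sum_l M i j k l *: (gx k * gx l).
Definition symR : lmodType K := qalg symR_rel.

Definition symR_dual_rel (t : TVd) : Prop := exists i j,
  t = q *: (gxd j * gxd i) - \sum_k \sum_l M k l i j *: (gxd l * gxd k).
Definition symR_dual : lmodType K := qalg symR_dual_rel.

Definition perm_on_generators (sigma : {linear tens TVd TV -> tens TV TVd}) :=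
  forall k l, sigma (gxd l ⊗ gx k) =
    q^-1 *: (\sum_i \sum_j P j k i l *: (gx i ⊗ gxd j))
    + Bmat P k l *: (1 ⊗ 1).

Definition perm_extension (sigma : {linear tens TVd TV -> tens TV TVd}) : Prop :=
  [/\ perm_on_generators sigma,
      forall t : tens (tens TVd TVd) TV,
        sigma (tmap (tmul TVd) idfun t) =
        tmap idfun (tmul TVd)
          (tassoc (tmap sigma idfun (tassocV (tmap idfun sigma (tassoc t))))),
      forall t : tens TVd (tens TV TV),
        sigma (tmap idfun (tmul TV) t) =
        tmap (tmul TV) idfun
          (tassocV (tmap idfun sigma (tassoc (tmap sigma idfun (tassocV t))))),
      forall b, sigma (1 ⊗ b) = b ⊗ 1
    & forall a, sigma (a ⊗ 1) = 1 ⊗ a].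

Definition descends (sigma : {linear tens TVd TV -> tens TV TVd}) : Prop :=
  exists sigmabar : {linear tens symR_dual symR -> tens symR symR_dual},
    forall t, sigmabar (tmap (qproj symR_dual_rel) (qproj symR_rel) t) =
              tmap (qproj symR_rel) (qproj symR_dual_rel) (sigma t).

(* descends asserts that sigma induces a map A ⊗ B -> B ⊗ A, with
   A = Sym_R(V^* ) and B = Sym_R(V); sigma itself is the unique extension of the
   permutation relations to the tensor algebras. *)
Definition compatible : Prop :=
  exists sigma : {linear tens TVd TV -> tens TV TVd},
    [/\ perm_extension sigma,
        forall tau : {linear tens TVd TV -> tens TV TVd},
          perm_extension tau -> tau =1 sigma
      & descends sigma].

(* The two forms of the permutation relations, for elements X_i and Y^i of an
   algebra D. *)
Definition perm_rel_R (D : algType K) (X Y : 'I_N -> D) : Prop :=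
  forall i j, \sum_a \sum_b M a i b j *: (Y a * X b) =
    q^-1 *: (X i * Y j) + (i == j)%:R *: 1.

Definition perm_rel_Psi (D : algType K) (X Y : 'I_N -> D) : Prop :=
  forall k l, Y l * X k =
    q^-1 *: (\sum_i \sum_j P j k i l *: (X i * Y j)) + Bmat P k l *: 1.

End PermutationRelations.

(* Main.v *)
From HB Require Import structures.
Require Import Defs.
From mathcomp Require Import all_boot all_order all_algebra.
From mathcomp Require Import reals complex.
From mathcomp Require Import finmap monalg.
Import GRing.Theory.
Local Open Scope ring_scope.

Set Implicit Arguments.
Unset Strict Implicit.
Unset Printing Implicit Defensive.

(** Write W for the dual of V, x_k for the basis of V and x^l for the dual
    basis of W.  The permutation map is built from an action.  The tensor
    product T(V) ⊗ T(W) is thought of as the space of ordered words, with the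
    x_k to the left of the x^l; x_k acts on it by left multiplication, and x^l
    acts by an operator Y_l that puts x^l in front of a word and moves it to the
    right with the permutation relations ([reorder_exists]).  Since T(W) is
    free, the Y_l generate an action of T(W), and
    sigma (a ⊗ b) = a acting on (b ⊗ 1) satisfies the three conditions because
    Y_l commutes with everything that only touches the far right of a word
    ([twist_mull], [twist_mulr]).  Those conditions determine sigma by induction
    on words ([perm_extension_unique]).

    The map descends when the space I(V) ⊗ T(W) + T(V) ⊗ I(W), the sum of the
    two ideals of relations, is stable under the Y_l and contains the image of
    every relation of Sym_R(W).  Both follow from two exchange rules: a
    quadratic relation in the x^l passes through x_k, and x^l passes through a
    quadratic relation in the x_k, each time giving relations of the same kind
    and no lower-order term ([qminus_YYX], [qminus_YXX]).

    To see the first rule, let J = Y Y (q - R) be the row of relations, indexed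
    by a basis of V ⊗ V.  Contracting Y Y X with two copies of R, as in the
    first form of the permutation relations, gives
        Y Y X . R_12 R_23 = q^-2 X Y Y + Y (q^-1 + R).
    Multiply by q - R on the right.  On the left the braid relation turns this
    factor into one that acts on Y Y alone, so Y Y becomes J.  On the right the
    linear term dies because (q^-1 + R)(q - R) = 0.  What is left is
        J X . R_12 R_23 = q^-2 X J
    ([contr2_qminus]).  Skew-invertibility says exactly that contraction with R
    can be undone, so each entry of J X is a combination of entries of X J.
    The second rule is the first one for the transpose of R. *)

(** * Linear maps, spans and finite sums *)

Definition linear_of (K : fieldType) (U W : lmodType K) (f : U -> W)
  (lf : linear f) : {linear U -> W} :=
  HB.pack f (GRing.isLinear.Build K U W *:%R f lf).

Lemma span_of_map (K : fieldType) (U W : lmodType K) (J : U -> Prop)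
    (S : submodClosed W) (f : {linear U -> W}) :
  (forall u, J u -> f u \in S) -> forall u, u \in span_of J -> f u \in S.
Proof.
move=> fJ u /span_ofP/(_ (fun u => f u \in S)); apply=> //.
split=> [|a v w Sv Sw].
  by rewrite linear0 rpred0.
by rewrite linearP; apply: rpredD => //; apply: rpredZ.
Qed.

Lemma span_of_gen (K : fieldType) (U : lmodType K) (J : U -> Prop) u :
  J u -> u \in span_of J.
Proof. by move=> Ju; apply/span_ofP => T _; apply. Qed.

Lemma linear_sum2 (K : fieldType) (N : nat) (U W : lmodType K)
    (g : {linear U -> W}) (c : 'I_N -> 'I_N -> K) (F : 'I_N -> 'I_N -> U) :
  g (\sum_i \sum_j c i j *: F i j) = \sum_i \sum_j c i j *: g (F i j).
Proof.
rewrite linear_sum; apply: eq_bigr => i _; rewrite linear_sum.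
by apply: eq_bigr => j _; rewrite linearZ.
Qed.

Lemma tpure_suml (K : fieldType) (N : nat) (U W : lmodType K) (w : W)
    (c : 'I_N -> 'I_N -> K) (F : 'I_N -> 'I_N -> U) :
  (\sum_i \sum_j c i j *: F i j) ⊗ w = \sum_i \sum_j c i j *: (F i j ⊗ w).
Proof. exact: (linear_sum2 (linear_of (@tpure_linearl _ _ _ w))). Qed.

Lemma tpure_sumr (K : fieldType) (N : nat) (U W : lmodType K) (u : U)
    (c : 'I_N -> 'I_N -> K) (F : 'I_N -> 'I_N -> W) :
  u ⊗ (\sum_i \sum_j c i j *: F i j) = \sum_i \sum_j c i j *: (u ⊗ F i j).
Proof. exact: (linear_sum2 (linear_of (@tpure_linearr _ _ _ u))). Qed.

Section DeltaSums.
Variables (K : fieldType) (N : nat) (U : lmodType K).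
Implicit Types (h : 'I_N -> 'I_N -> U).

Lemma sum_delta (F : 'I_N -> U) j : \sum_i (i == j)%:R *: F i = F j.
Proof.
rewrite (bigD1 j) //= eqxx scale1r big1 ?addr0 // => i /negPf ->.
by rewrite scale0r.
Qed.

Lemma sum2_delta h a0 b0 :
  \sum_a \sum_b ((a == a0)%:R * (b == b0)%:R) *: h a b = h a0 b0.
Proof.
rewrite -[RHS](sum_delta (h^~ b0) a0); apply: eq_bigr => a _.
rewrite -[h a b0](sum_delta (h a) b0) scaler_sumr.
by apply: eq_bigr => b _; rewrite scalerA.
Qed.

Lemma sum2_comp (C : 'I_N -> 'I_N -> K) (D : coefs K N) h :
  \sum_i \sum_j C i j *: (\sum_a \sum_b D a b i j *: h a b) =
  \sum_a \sum_b (\sum_i \sum_j C i j * D a b i j) *: h a b.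
Proof.
rewrite !pair_bigA /=.
under eq_bigr do rewrite pair_bigA scaler_sumr /=.
rewrite exchange_big /=; apply: eq_bigr => ab _.
by rewrite pair_bigA scaler_suml /=; apply: eq_bigr => ij _; rewrite scalerA.
Qed.

End DeltaSums.

(** * R-matrices in coordinates *)

Section Coefficients.
Variables (K : fieldType) (N : nat).
Implicit Types (M P : coefs K N).

(** With rows (a, b) and columns (i, j), the entries M a i b j form a square
    matrix, of which the skew inverse is a one-sided inverse, hence a two-sided one. *)
Lemma skew_inverse_sym M P : skew_inverse M P -> forall i j i' j',
  \sum_a \sum_b M a i b j * P j' b i' a = (i' == i)%:R * (j' == j)%:R.
Proof.
move=> MP i j i' j'; pose n := #|{: 'I_N * 'I_N}|.
pose A : 'M[K]_n := \matrix_(u, v)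
  let ab := enum_val u in let ij := enum_val v in M ab.1 ij.1 ab.2 ij.2.
pose B : 'M[K]_n := \matrix_(v, u)
  let ab := enum_val u in let ij := enum_val v in P ij.2 ab.2 ij.1 ab.1.
have AB : A *m B = 1%:M.
  apply/matrixP => u w; rewrite !mxE -(inj_eq enum_val_inj).
  case Eu: (enum_val u) => [a b]; case Ew: (enum_val w) => [a' b'].
  rewrite xpair_eqE -mulnb natrM mulrC (eq_sym b) -(MP a b b' a') pair_bigA /=.
  rewrite (reindex (@enum_rank _)) /=; last first.
    by apply: onW_bij; exact: enum_rank_bij.
  by apply: eq_bigr => ij _; rewrite !mxE Eu Ew !enum_rankK.
have /matrixP/(_ (enum_rank (i', j')) (enum_rank (i, j))) := mulmx1C AB.
rewrite !mxE (inj_eq enum_rank_inj) xpair_eqE -mulnb natrM => <-.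
rewrite pair_bigA /= (reindex (@enum_rank _)) /=; last first.
    by apply: onW_bij; exact: enum_rank_bij.
by apply: eq_bigr => ab _; rewrite !mxE !enum_rankK /= mulrC.
Qed.

(** The coefficient of x_d ⊗ x_e ⊗ x_f in the braid relation at
    x_a ⊗ x_b ⊗ x_c. *)
Definition braid_coefs M := forall a b c d e f,
  \sum_i \sum_j \sum_k M a b i j * M j c k f * M i k d e =
  \sum_i \sum_j \sum_k M b c i j * M a i d k * M k j e f.

(** The relation (R - q)(R + q^-1) = 0, solved for the square of R. *)
Definition hecke_coefs (q : K) M := forall a b d e,
  \sum_i \sum_j M a b i j * M i j d e =
  (a == d)%:R * (b == e)%:R + (q - q^-1) * M a b d e.

(** Transposing R exchanges the roles of the x_k and of the x^l. *)
Definition coefs_tr M : coefs K N := fun a b c d => M c d a b.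

Lemma braid_coefs_tr M : braid_coefs M -> braid_coefs (coefs_tr M).
Proof.
move=> MB a b c d e f; rewrite /coefs_tr.
transitivity (\sum_i \sum_k \sum_j M d e i k * M k f j c * M i j a b).
  apply: eq_bigr => i _; rewrite exchange_big; apply: eq_bigr => j _.
  by apply: eq_bigr => k _; rewrite -mulrA mulrC [X in X * _]mulrC.
rewrite MB exchange_big /=; under eq_bigr do rewrite exchange_big /=.
rewrite exchange_big /=; apply: eq_bigr => i _; apply: eq_bigr => j _.
by apply: eq_bigr => k _; rewrite -mulrA mulrC [X in X * _]mulrC.
Qed.

Lemma hecke_coefs_tr q M : hecke_coefs q M -> hecke_coefs q (coefs_tr M).
Proof.
move=> MH a b d e; rewrite /coefs_tr (eq_sym a) (eq_sym b) -MH.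
by apply: eq_bigr => i _; apply: eq_bigr => j _; rewrite mulrC.
Qed.

Lemma skew_inverse_tr M P :
  skew_inverse M P -> skew_inverse (coefs_tr M) (coefs_tr P).
Proof.
move=> MP i k m n; rewrite mulrC (eq_sym m) (eq_sym i) -(MP k i n m).
by rewrite exchange_big.
Qed.

Lemma hecke_coefs_factor q M : q != 0 -> hecke_coefs q M -> forall a b d e,
  \sum_i \sum_j (q^-1 * ((a == i)%:R * (b == j)%:R) + M a b i j) *
    (q * ((i == d)%:R * (j == e)%:R) - M i j d e) = 0.
Proof.
move=> q0 MH a b d e.
have dl (F : 'I_N -> 'I_N -> K) u v :
  \sum_i \sum_j ((u == i)%:R * (v == j)%:R) * F i j = F u v.
  rewrite -[RHS](@sum2_delta K N K^o F); apply: eq_bigr => i _.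
  by apply: eq_bigr => j _; rewrite (eq_sym u) (eq_sym v).
transitivity (\sum_i \sum_j
  (((a == i)%:R * (b == j)%:R) *
     (((i == d)%:R * (j == e)%:R) - q^-1 * M i j d e) +
   (((d == i)%:R * (e == j)%:R) * (q * M a b i j) - M a b i j * M i j d e))).
  apply: eq_bigr => i _; apply: eq_bigr => j _.
  rewrite (eq_sym d) (eq_sym e) mulrDl !mulrBr; congr (_ - _ + (_ - _)).
  - by rewrite mulrACA mulVf // mul1r.
  - by rewrite -mulrA mulrCA.
  - by rewrite mulrCA mulrA mulrC.
under eq_bigr do rewrite big_split /= sumrB.
rewrite big_split /= sumrB !dl MH mulrBl opprD opprB.
rewrite [q * _ + _]addrCA [q * _ + _]addrC subrK [- _ + _]addrC addrA.
by rewrite !subrK subrr.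
Qed.

End Coefficients.

Section Contraction.
Variables (K : fieldType) (N : nat) (U : lmodType K).
Implicit Types (M P : coefs K N) (h : 'I_N -> 'I_N -> U).

(** The left-hand side of the first form of the permutation relations, with
    h a b in the place of the product of x^a and x_b.  The sum is over a lower
    and an upper index of R, so that this is inverted by the skew inverse of R
    and not by its inverse. *)
Definition contr M h i j := \sum_a \sum_b M a i b j *: h a b.
Definition uncontr P h a b := \sum_i \sum_j P j b i a *: h i j.

Lemma eq_contr M h h' : (forall a b, h a b = h' a b) ->
  forall i j, contr M h i j = contr M h' i j.
Proof.
by move=> E i j; apply: eq_bigr => a _; apply: eq_bigr => b _; rewrite E.
Qed.

Lemma contr_linear M (f : {linear U -> U}) h i j :
  contr M (fun a b => f (h a b)) i j = f (contr M h i j).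
Proof.
rewrite linear_sum; apply: eq_bigr => a _; rewrite linear_sum.
by apply: eq_bigr => b _; rewrite linearZ.
Qed.

Lemma contrD M h h' c i j :
  contr M (fun a b => c *: h a b + h' a b) i j =
  c *: contr M h i j + contr M h' i j.
Proof.
rewrite scaler_sumr -big_split; apply: eq_bigr => a _ /=.
rewrite scaler_sumr -big_split; apply: eq_bigr => b _ /=.
by rewrite scalerDr !scalerA mulrC.
Qed.

Lemma contrK M P h : skew_inverse M P ->
  forall a b, uncontr P (contr M h) a b = h a b.
Proof.
move=> MP a b; rewrite /uncontr sum2_comp -[RHS]sum2_delta.
apply: eq_bigr => a' _; apply: eq_bigr => b' _; congr (_ *: _).
rewrite mulrC (eq_sym b') -(MP a' b' b a) exchange_big.
rewrite exchange_big; apply: eq_bigr => i _; apply: eq_bigr => j _.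
by rewrite mulrC.
Qed.

Lemma uncontrK M P h : skew_inverse M P ->
  forall i j, contr M (uncontr P h) i j = h i j.
Proof.
move=> MP i j; rewrite /contr sum2_comp -[RHS]sum2_delta.
apply: eq_bigr => i' _; apply: eq_bigr => j' _; congr (_ *: _).
exact: skew_inverse_sym.
Qed.

(** R acting from the right on rows indexed by the basis of V ⊗ V; the relations
    of both quadratic algebras are entries of rows h (q - R), where R is
    transposed for those in the x_k. *)
Definition coact M h a b := \sum_k \sum_l M k l a b *: h k l.
Definition qminus q M h a b := q *: h a b - coact M h a b.

(** For G b a c the product of x^a, x^b and x_c, the inner contraction carries
    x_c past x^b and the outer one carries it past x^a. *)
Definition contr2 M (G : 'I_N -> 'I_N -> 'I_N -> U) n j p :=
  contr M (fun a i => contr M (fun b c => G b a c) i j) n p.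

Lemma contr2E M G n j p : contr2 M G n j p =
  \sum_b \sum_a \sum_c (\sum_i M a n i p * M b i c j) *: G b a c.
Proof.
rewrite /contr2 /contr [RHS]exchange_big /=; apply: eq_bigr => a _.
under eq_bigr do rewrite pair_bigA scaler_sumr /=.
rewrite exchange_big [RHS]pair_bigA /=; apply: eq_bigr => bc _.
by rewrite scaler_suml; apply: eq_bigr => i _; rewrite scalerA.
Qed.

(** The coefficients of [contr2] are the matrix of R_12 R_23 from the triple (b, a, n)
    to the triple (c, j, p).  By the braid relation, R_12 applied before it is
    R_23 applied after it. *)
Lemma contr2_braid M G : braid_coefs M -> forall n j p,
  contr2 M (fun b a c => coact M (fun k l => G k l c) b a) n j p =
  coact M (fun j' p' => contr2 M G n j' p') j p.
Proof.
move=> MB n j p; rewrite contr2E /coact /=.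
under [RHS]eq_bigr do under eq_bigr do rewrite contr2E.
transitivity (\sum_k \sum_l \sum_c
    (\sum_b \sum_a \sum_i M k l b a * M a n i p * M b i c j) *: G k l c).
  rewrite [LHS]pair_bigA [RHS]pair_bigA /=.
  under eq_bigr do under eq_bigr do rewrite pair_bigA scaler_sumr /=.
  under [RHS]eq_bigr => kl _ do under eq_bigr => c _ do
    rewrite pair_bigA scaler_suml /=.
  under [RHS]eq_bigr do rewrite exchange_big /=.
  rewrite [RHS]exchange_big /=; apply: eq_bigr => ba _.
  rewrite [RHS]exchange_big /=; apply: eq_bigr => c _.
  apply: eq_bigr => kl _; rewrite scalerA mulr_suml; congr (_ *: _).
  by apply: eq_bigr => i _; rewrite -[RHS]mulrA [RHS]mulrC.
rewrite [LHS]pair_bigA [RHS]pair_bigA /=.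
under [RHS]eq_bigr do rewrite pair_bigA scaler_sumr /=.
rewrite [RHS]exchange_big /=; apply: eq_bigr => kl _.
under [RHS]eq_bigr do rewrite scaler_sumr.
rewrite [RHS]exchange_big /=; apply: eq_bigr => c _.
under [RHS]eq_bigr do rewrite scalerA.
rewrite -scaler_suml; congr (_ *: _); rewrite MB.
under [LHS]eq_bigr do rewrite exchange_big /=.
rewrite exchange_big /= -[RHS](pair_bigA _ (fun j' p' =>
  M j' p' j p * \sum_i M kl.2 n i p' * M kl.1 i c j')) /=.
apply: eq_bigr => j' _; rewrite exchange_big /=; apply: eq_bigr => p' _.
by rewrite mulr_sumr; apply: eq_bigr => i _; rewrite mulrC.
Qed.

(** The exchange rule in abstract form: G is a product of three factors, H the
    product reordered by two applications of the permutation relations, and the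
    sum is the linear remainder L (q^-1 + R).  The factor q - R commutes with
    [contr2] by the braid relation and kills the remainder by the Hecke
    relation. *)
Lemma contr2_qminus q M G H (L : 'I_N -> U) :
  q != 0 -> braid_coefs M -> hecke_coefs q M ->
  (forall n j p, contr2 M G n j p =
     (q^-1 ^+ 2) *: H n j p +
     \sum_a (q^-1 * ((a == j)%:R * (n == p)%:R) + M a n j p) *: L a) ->
  forall n j p,
    contr2 M (fun b a c => qminus q M (fun k l => G k l c) b a) n j p =
    (q^-1 ^+ 2) *: qminus q M (H n) j p.
Proof.
move=> q0 MB MH E n j p.
have -> : contr2 M (fun b a c => qminus q M (fun k l => G k l c) b a) n j p =
    qminus q M (contr2 M G n) j p.
  rewrite /qminus -contr2_braid // !contr2E scaler_sumr -sumrB.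
  apply: eq_bigr => b _; rewrite scaler_sumr -sumrB; apply: eq_bigr => a _.
  rewrite scaler_sumr -sumrB; apply: eq_bigr => c _.
  by rewrite scalerBr !scalerA mulrC.
pose T j p := \sum_a (q^-1 * ((a == j)%:R * (n == p)%:R) + M a n j p) *: L a.
have qminusE h u v : qminus q M h u v =
  \sum_i \sum_j (q * ((i == u)%:R * (j == v)%:R) - M i j u v) *: h i j.
  transitivity (\sum_i \sum_j
    ((q * ((i == u)%:R * (j == v)%:R)) *: h i j - M i j u v *: h i j));
    last first.
    by apply: eq_bigr => i _; apply: eq_bigr => k _; rewrite scalerBl.
  under eq_bigr do rewrite sumrB; rewrite sumrB; congr (_ - _).
  rewrite -sum2_delta scaler_sumr; apply: eq_bigr => i _.
  by rewrite scaler_sumr; apply: eq_bigr => k _; rewrite scalerA.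
have T0 : qminus q M T j p = 0.
  rewrite qminusE /T.
  under eq_bigr do under eq_bigr do rewrite scaler_sumr.
  rewrite pair_bigA exchange_big /= big1 // => a _.
  under eq_bigr do rewrite scalerA.
  rewrite -scaler_suml -[X in X *: _](pair_bigA _ (fun i k =>
    (q * ((i == j)%:R * (k == p)%:R) - M i k j p) *
    (q^-1 * ((a == i)%:R * (n == k)%:R) + M a n i k))) /=.
  rewrite [X in X *: _](_ : _ = 0) ?scale0r //.
  rewrite -[RHS](hecke_coefs_factor q0 MH a n j p).
  by apply: eq_bigr => i _; apply: eq_bigr => k _; rewrite mulrC.
transitivity (q^-1 ^+ 2 *: qminus q M (H n) j p + qminus q M T j p); last first.
  by rewrite T0 addr0.
rewrite !qminusE scaler_sumr -big_split /=.
apply: eq_bigr => i _; rewrite scaler_sumr -big_split /=; apply: eq_bigr => k _.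
by rewrite E scalerDr !scalerA [_ * q^-1 ^+ 2]mulrC.
Qed.

Lemma contr_tr M h i j :
  contr (coefs_tr M) h i j = contr M (fun b a => h a b) j i.
Proof. by rewrite /contr exchange_big. Qed.

(** Since contractions are invertible, the contracted identities that the
    exchange rules provide suffice to place every single entry in a subspace. *)
Lemma contr2_mem (S : submodClosed U) M P (G : 'I_N -> 'I_N -> 'I_N -> U) :
  skew_inverse M P -> (forall n j p, contr2 M G n j p \in S) ->
  forall b a c, G b a c \in S.
Proof.
move=> MP GS b a c.
have mem h : (forall i j, contr M h i j \in S) -> forall u v, h u v \in S.
  move=> hS u v; rewrite -(contrK h MP); apply: rpred_sum => i _.
  by apply: rpred_sum => j _; apply: rpredZ.
apply: (mem (fun b c => G b a c)) => i j.
by apply: (mem (fun a i => contr M (fun b c => G b a c) i j)) => n p; apply: GS.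
Qed.

End Contraction.

Lemma qminus_linear (K : fieldType) N (U W : lmodType K) (f : {linear U -> W}) q
    (M : coefs K N) h a b :
  f (qminus q M h a b) = qminus q M (fun k l => f (h k l)) a b.
Proof. by rewrite /qminus linearB linearZ /coact linear_sum2. Qed.

Section Operators.
Variables (K : fieldType) (N : nat) (U : lmodType K) (q : K) (M : coefs K N).
Variables (X Y : 'I_N -> {linear U -> U}).
Hypotheses (q0 : q != 0) (MB : braid_coefs M) (MH : hecke_coefs q M).
Hypothesis XY : forall i j s, contr M (fun a b => Y a (X b s)) i j =
  q^-1 *: X i (Y j s) + (i == j)%:R *: s.

(** A relation in the Y passes through X.  The two deltas of the permutation
    relations give the terms q^-1 delta and R of the linear remainder. *)
Lemma qminus_YYX s n j p :
  contr2 M (fun b a c => qminus q M (fun k l => Y l (Y k (X c s))) b a) n j p =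
  (q^-1 ^+ 2) *: qminus q M (fun k l => X n (Y l (Y k s))) j p.
Proof.
apply: (contr2_qminus (G := fun b a c => Y a (Y b (X c s)))
  (H := fun n k l => X n (Y l (Y k s))) (L := fun a => Y a s)) => //.
move=> {}n {}j {}p.
rewrite /contr2.
under eq_contr => a i do rewrite contr_linear XY linearD !linearZ /=.
rewrite contrD XY scalerDr !scalerA -expr2 -addrA; congr (_ + _).
under [RHS]eq_bigr do rewrite scalerDl.
rewrite big_split /=; congr (_ + _).
  rewrite -(sum_delta (fun a => Y a s) j) !scaler_sumr.
  by apply: eq_bigr => a _; rewrite !scalerA -mulrA [_%:R * _]mulrC.
apply: eq_bigr => a _; rewrite -(sum_delta (fun i => M a n i p *: Y a s) j).
by apply: eq_bigr => i _; rewrite !scalerA mulrC.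
Qed.

(** Y passes through a relation in the X: the same rule for the transpose of R,
    with the order of the three factors reversed in the indices of G. *)
Lemma qminus_YXX s n j p :
  contr2 (coefs_tr M) (fun b a c =>
    qminus q (coefs_tr M) (fun k l => Y c (X k (X l s))) b a) n j p =
  (q^-1 ^+ 2) *: qminus q (coefs_tr M) (fun k l => X k (X l (Y n s))) j p.
Proof.
apply: (contr2_qminus (G := fun b a c => Y c (X b (X a s)))
  (H := fun n k l => X k (X l (Y n s))) (L := fun a => X a s)) => //;
  [exact: braid_coefs_tr | exact: hecke_coefs_tr |] => {}n {}j {}p.
rewrite /contr2 contr_tr.
under eq_contr => b a do rewrite contr_tr XY.
rewrite contrD contr_linear XY.
rewrite linearD !linearZ /= scalerDr !scalerA -expr2 -addrA.
congr (_ + _); under [RHS]eq_bigr do rewrite scalerDl.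
rewrite big_split /=; congr (_ + _).
  rewrite -(sum_delta (fun a => X a s) j) !scaler_sumr; apply: eq_bigr => a _.
  by rewrite !scalerA -mulrA [_%:R * _]mulrC (eq_sym p).
rewrite /contr exchange_big /=; apply: eq_bigr => a _.
rewrite -(sum_delta (fun b => M b p a n *: X a s) j).
by apply: eq_bigr => b _; rewrite !scalerA mulrC (eq_sym b).
Qed.
End Operators.

(** * The two forms of the permutation relations *)

Section PermutationRelationForms.
Variables (K : fieldType) (N : nat) (q : K) (M P : coefs K N).
Hypothesis MP : skew_inverse M P.

(** The matrix B is the skew inverse contracted with delta, so the second form
    of the permutation relations is the first one with R moved to the right-hand
    side. *)
Lemma uncontr_unit (U : lmodType K) h (z : U) a b :
  q^-1 *: uncontr P h a b + Bmat P b a *: z =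
  uncontr P (fun i j => q^-1 *: h i j + (i == j)%:R *: z) a b.
Proof.
rewrite /Bmat scaler_suml scaler_sumr -big_split; apply: eq_bigr => i _ /=.
rewrite -(sum_delta (fun j => P j b i a *: z)) scaler_sumr -big_split /=.
apply: eq_bigr => j _; rewrite scalerDr !scalerA (eq_sym j).
by rewrite [q^-1 * _]mulrC [_%:R * _]mulrC.
Qed.

Lemma contr_eq_uncontr (U : lmodType K) (h g : 'I_N -> 'I_N -> U) :
  (forall i j, contr M h i j = g i j) <-> (forall a b, h a b = uncontr P g a b).
Proof.
split=> E a b; last by rewrite -[RHS](uncontrK g MP); apply: eq_contr.
rewrite -[LHS](contrK h MP); apply: eq_bigr => i _; apply: eq_bigr => j _.
by rewrite E.
Qed.

Lemma perm_rel_equiv (D : algType K) (X Y : 'I_N -> D) :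
  perm_rel_R q M X Y <-> perm_rel_Psi q P X Y.
Proof.
have E := contr_eq_uncontr (fun a b => Y a * X b)
  (fun i j => q^-1 *: (X i * Y j) + (i == j)%:R *: 1).
split=> [/E H k l|H].
  by rewrite [LHS]H -uncontr_unit.
by apply/E => a b; rewrite [LHS]H -uncontr_unit.
Qed.
End PermutationRelationForms.

(** * Actions of a tensor algebra *)

Section TensorAlgebraAction.
Variables (K : fieldType) (V X : lmodType K) (act : V -> X -> X).
Hypothesis act_bilin : bilin act.

Let word (m : {fmonom V}) (z : X) : X := foldr act z (fmonom_val m).

Let run (g : falg V) (z : X) : X :=
  \sum_(m <- msupp g) (g : {malg K[{fmonom V}]})@_m *: word m z.

Let word_linear m : linear (word m).
Proof.
rewrite /word => a z z'; elim: (fmonom_val m) => //= v s ->.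
exact: (bilinR act_bilin).
Qed.

Let runE (d : {fset {fmonom V}}) (g : falg V) z : (msupp g `<=` d)%fset ->
  run g z = \sum_(m <- d) (g : {malg K[{fmonom V}]})@_m *: word m z.
Proof.
move=> le; rewrite [LHS](big_fset_incl _ le) => //= m md /mcoeff_outdom ->.
by rewrite scale0r.
Qed.

Let run_bilin : bilin run.
Proof.
split=> [z a g1 g2|g a z z'].
  have s1 := fsubsetUl (msupp g1) (msupp g2).
  have s2 := fsubsetUr (msupp g1) (msupp g2).
  have s3 : (msupp (a *: g1 + g2) `<=` msupp g1 `|` msupp g2)%fset.
    apply: fsubset_trans (msuppD_le _ _) _; apply: fsetSU; exact: msuppZ_le.
  rewrite (runE _ s1) (runE _ s2) (runE _ s3) scaler_sumr -big_split /=.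
  by apply: eq_bigr => m _; rewrite mcoeffD mcoeffZ scalerDl scalerA.
rewrite /run scaler_sumr -big_split; apply: eq_bigr => m _ /=.
by rewrite word_linear scalerDr !scalerA mulrC.
Qed.

Let run_mon m z : run (mkmalgU m 1) z = word m z.
Proof. by rewrite (runE _ msuppU_le) big_seq_fset1 mcoeffUU scale1r. Qed.

Let runl z : {linear falg V -> X} := linear_of (bilinL run_bilin z).
Let runr g : {linear X -> X} := linear_of (bilinR run_bilin g).

Let runM g h z : run (g * h) z = run g (run h z).
Proof.
have -> : g * h = \sum_(m <- msupp g) \sum_(n <- msupp h)
    ((g : {malg K[{fmonom V}]})@_m * (h : {malg K[{fmonom V}]})@_n) *:
      (mkmalgU (mmul m n) 1 : falg V).
  rewrite [LHS]malgME; apply: eq_bigr => m _; apply: eq_bigr => n _.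
  by apply/malgP => k; rewrite mcoeffZ !mcoeffU mulrnAr mulr1.
rewrite -[LHS]/(runl z _) linear_sum; apply: eq_bigr => m _.
pose wm := linear_of (word_linear m).
rewrite -[word m _]/(wm _) [in RHS]/run !linear_sum; apply: eq_bigr => n _.
rewrite !linearZ /= scalerA run_mon mulrC; congr (_ *: _).
by rewrite /word fmM foldr_cat.
Qed.

Let run_letter v z : run (letter v) z = act v z.
Proof. by rewrite run_mon /word fmU. Qed.

Let run_ideal g z : g \in span_of (sandwich (@letter_rel K V)) -> run g z = 0.
Proof.
move/span_ofP/(_ (fun g => run g z = 0)); apply.
  split=> [|a u v hu hv]; first exact: (linear0 (runl z)).
  by rewrite (bilinL run_bilin) hu hv scaler0 addr0.
move=> _ [a [_ [b [[c [u [v ->]]] ->]]]]; rewrite !runM.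
rewrite -[run (_ - _) _]/(runl _ _) linearB linearP /= !run_letter.
by rewrite (bilinL act_bilin) subrr -[LHS]/(runr a 0) linear0.
Qed.

(** A linear family of operators on X extends to T(V): words act letter by
    letter, and linearity of the family kills the relations that make letters
    linear. *)
Lemma talg_action : exists A : talg V -> X -> X,
  [/\ bilin A, forall z, A 1 z = z
    & forall v t z, A (tvar v * t) z = act v (A t z)].
Proof.
rewrite /tvar /talg talg_data.unlock /=.
pose A (t : talg_sort V) z := run (reprm t) z.
have AE g z : A (qproj (@letter_rel K V) g) z = run g z.
  apply/subr0_eq; rewrite -[X in X - _]/(runl z _) -[X in _ - X]/(runl z _).
  by rewrite -linearB; apply: run_ideal; apply/projm_eq; exact: projm_surj.
exists A; split=> [|z|v t z].
- split=> [z a s t|t a z z']; last exact: bilinR run_bilin _ _ _ _.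
  rewrite -[s]qproj_surj -[t]qproj_surj -linearP !AE.
  exact: bilinL run_bilin _ _ _ _.
- by rewrite -[1]/(qproj (@letter_rel K V) 1) AE run_mon /word fm1.
by rewrite -[t]qproj_surj -[_ * _]qprojM !AE runM run_letter.
Qed.

End TensorAlgebraAction.

Section BasisAction.
Variables (K : fieldType) (V : vectType K) (N : nat) (x : N.-tuple V).
Hypothesis hx : basis_of fullv x.

Lemma basis_coord v : v = \sum_i coord x i v *: tnth x i.
Proof.
rewrite {1}(coord_basis hx (memvf v)); apply: eq_bigr => i _.
by rewrite (tnth_nth 0).
Qed.

Lemma coord_tnth i j : coord x i (tnth x j) = (j == i)%:R.
Proof. by rewrite (tnth_nth 0) coord_free ?(basis_free hx) // eq_sym. Qed.

Lemma talg_basis_ind (P : talg V -> Prop) :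
  P 1 -> (forall a s t, P s -> P t -> P (a *: s + t)) ->
  (forall k t, P t -> P (tvar (tnth x k) * t)) -> forall t, P t.
Proof.
move=> P1 PD PM; apply: talg_ind => // v t Pt.
rewrite (basis_coord v) linear_sum mulr_suml.
have P0 : P 0 by have := PD (-1) _ _ P1 P1; rewrite scaleN1r addNr.
apply: (big_ind P) => // [s u Ps Pu|k _].
  by rewrite -[s]scale1r; apply: PD.
by rewrite linearZ -scalerAl -[_ *: _]addr0; apply: PD => //; apply: PM.
Qed.

Lemma talg_basis_action (X : lmodType K) (D : 'I_N -> {linear X -> X}) :
  exists A : talg V -> X -> X,
  [/\ bilin A, forall z, A 1 z = z
    & forall k t z, A (tvar (tnth x k) * t) z = D k (A t z)].
Proof.
have actB : bilin (fun v z => \sum_k coord x k v *: D k z).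
  split=> [z a u v|v a z z']; rewrite scaler_sumr -big_split /=.
    by apply: eq_bigr => k _; rewrite linearP scalerDl scalerA.
  by apply: eq_bigr => k _; rewrite linearP scalerDr !scalerA mulrC.
have [A [AB A1 AS]] := talg_action actB; exists A; split=> // k t z.
rewrite AS -[RHS](sum_delta (fun k => D k (A t z))); apply: eq_bigr => i _.
by rewrite coord_tnth eq_sym.
Qed.
End BasisAction.

(** * Matrix form of the braid and Hecke relations *)

Fact op23_is_linear (K : fieldType) (V : vectType K)
  (f : {linear tens V V -> tens V V}) : linear (op23 f).
Proof. by move=> a u v; rewrite /op23 !linearP. Qed.
HB.instance Definition _ (K : fieldType) (V : vectType K)
    (f : {linear tens V V -> tens V V}) :=
  GRing.isLinear.Build K (tens (tens V V) V) (tens (tens V V) V) *:%R (op23 f)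
    (op23_is_linear f).

Section TensorCoordinates.
Variables (K : fieldType) (V : vectType K) (N : nat) (x : N.-tuple V).
Hypothesis hx : basis_of fullv x.
Variables (f : {linear tens V V -> tens V V}) (M : coefs K N).
Hypothesis fM : has_matrix x f M.

Fact coord2_bilin k l :
  bilin (fun u v : V => coord x k u * coord x l v : K^o).
Proof.
split=> [v a u u'|u a v v']; rewrite linearP /=; first by rewrite mulrDl -mulrA.
by rewrite mulrDr /= mulrCA.
Qed.
Definition coord2 k l : {linear tens V V -> K^o} := tlift (coord2_bilin k l).

Fact coord3_bilin k l m :
  bilin (fun (t : tens V V) (v : V) => coord2 k l t * coord x m v : K^o).
Proof.
split=> [v a u u'|u a v v']; rewrite linearP /=; first by rewrite mulrDl -mulrA.
by rewrite mulrDr /= mulrCA.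
Qed.
Definition coord3 k l m : {linear tens (tens V V) V -> K^o} :=
  tlift (coord3_bilin k l m).

Lemma coord2E k l i j : coord2 k l (tnth x i ⊗ tnth x j) =
  (i == k)%:R * (j == l)%:R.
Proof. by rewrite /coord2 /= tliftE !(coord_tnth hx). Qed.

Lemma coord3E k l m i j p : coord3 k l m (tnth x i ⊗ tnth x j ⊗ tnth x p) =
  (i == k)%:R * (j == l)%:R * (p == m)%:R.
Proof. by rewrite /coord3 /= tliftE coord2E (coord_tnth hx). Qed.

Lemma coord2_has_matrix k l i j :
  coord2 k l (f (tnth x i ⊗ tnth x j)) = M i j k l.
Proof.
rewrite fM linear_sum2 -[RHS](sum2_delta (M i j : 'I_N -> 'I_N -> K^o)).
apply: eq_bigr => m _; apply: eq_bigr => n _.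
by rewrite coord2E /GRing.scale /= mulrC.
Qed.

Lemma has_matrix_hecke q : q != 0 -> hecke_symmetry q f -> hecke_coefs q M.
Proof.
move=> q0 [_ H] a b d e; have := congr1 (coord2 d e) (H (tnth x a ⊗ tnth x b)).
rewrite /= !(linearB, linearD, linearZ) /= {1}fM linear0.
rewrite -[coord2 d e (f (\sum_i _))]/((coord2 d e \o f) _) linear_sum2 /=.
under eq_bigr do under eq_bigr do rewrite coord2_has_matrix.
rewrite !coord2_has_matrix coord2E.
move=> H0; apply/eqP; rewrite -subr_eq0; apply/eqP; rewrite -[RHS]H0.
rewrite scalerDr scalerA mulfV // scale1r scalerN mulrBl opprD opprB -!addrA.
by congr (_ + _); rewrite addrCA; congr (_ + _); rewrite addrC.
Qed.

(** Both sides of the braid relation are expanded on a basis tensor, and the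
    last operator applied is read off through a coordinate form. *)
Lemma has_matrix_braid : braiding f -> braid_coefs M.
Proof.
move=> H a b c d e p.
pose g a b c := tnth x a ⊗ tnth x b ⊗ tnth x c.
have o12 i j k : op12 f (g i j k) = \sum_m \sum_n M i j m n *: g m n k.
  rewrite /op12 /= tmapE fM /=.
  exact: tpure_suml.
have o23 i j k : op23 f (g i j k) = \sum_m \sum_n M j k m n *: g i m n.
  rewrite /op23 tassocE tmapE fM /=.
  rewrite tpure_sumr linear_sum2; apply: eq_bigr => m _; apply: eq_bigr => n _.
  by rewrite /= tassocVE.
have c12 i j k : coord3 d e p (op12 f (g i j k)) = M i j d e * (k == p)%:R.
  rewrite o12 linear_sum2 -[M i j d e](sum2_delta (M i j : _ -> _ -> K^o)).
  rewrite mulr_suml; apply: eq_bigr => m _; rewrite mulr_suml.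
  apply: eq_bigr => n _; rewrite coord3E /GRing.scale /=.
  by rewrite mulrA (mulrC (M _ _ _ _)).
have c23 i j k : coord3 d e p (op23 f (g i j k)) = (i == d)%:R * M j k e p.
  rewrite o23 linear_sum2 -[M j k e p](sum2_delta (M j k : _ -> _ -> K^o)).
  rewrite mulr_sumr; apply: eq_bigr => m _; rewrite mulr_sumr.
  by apply: eq_bigr => n _; rewrite coord3E /GRing.scale /= mulrC -!mulrA.
have := congr1 (coord3 d e p) (H (g a b c)).
rewrite o12 o23 !linear_sum2 => E.
transitivity (\sum_i \sum_j
  M a b i j *: (coord3 d e p (op12 f (op23 f (g i j c))) : K^o)).
  apply: eq_bigr => i _; apply: eq_bigr => j _.
  rewrite o23 !linear_sum2; apply: eq_bigr => k _.
  rewrite -(sum_delta (fun n => M a b i j * M j c k n * M i k d e : K^o) p).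
  apply: eq_bigr => n _; rewrite c12 /GRing.scale /=.
  by rewrite mulrC !mulrA [M j c k n * _]mulrC.
rewrite [LHS]E; apply: eq_bigr => i _; apply: eq_bigr => j _.
rewrite o12 !linear_sum2 exchange_big; apply: eq_bigr => k _.
rewrite -[RHS](sum_delta (fun l => M b c i j * M a i l k * M k j e p : K^o) d).
apply: eq_bigr => l _; rewrite c23 /GRing.scale /=.
by rewrite [LHS]mulrCA [M a i l k * _]mulrCA [LHS]mulrCA !mulrA.
Qed.
End TensorCoordinates.

(** * Multiplication in a tensor product of algebras *)

Section Multiplication.
Variables (K : fieldType) (A B : algType K).

Fact mull_is_linear (b : A) : linear (fun c : A => b * c).
Proof. by move=> a u v; rewrite mulrDr scalerAr. Qed.
Fact mulr_is_linear (b : A) : linear (fun c : A => c * b).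
Proof. by move=> a u v; rewrite mulrDl scalerAl. Qed.

Definition lmul (b : A) : {linear tens A B -> tens A B} :=
  tmap (linear_of (mull_is_linear b)) idfun.
Lemma lmulE b (c : A) (d : B) : lmul b (c ⊗ d) = (b * c) ⊗ d.
Proof. by rewrite /lmul /= tmapE. Qed.

Lemma lmulM b c t : lmul (b * c) t = lmul b (lmul c t).
Proof.
elim/tens_ind: t => [|a u w t IH]; first by rewrite !linear0.
by rewrite !linearP IH /= !lmulE mulrA.
Qed.
Lemma lmul1 t : lmul 1 t = t.
Proof.
elim/tens_ind: t => [|a u w t IH]; first by rewrite !linear0.
by rewrite !linearP IH /= !lmulE mul1r.
Qed.
Lemma lmul_linearl t : linear (lmul^~ t).
Proof.
move=> a b c; elim/tens_ind: t => [|a' u w t IH].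
  by rewrite !linear0 addr0.
rewrite !linearP IH /= !lmulE mulrDl -scalerAl tpure_linearl !scalerDr !scalerA.
by rewrite mulrC addrACA.
Qed.
End Multiplication.

Section RightMultiplication.
Variables (K : fieldType) (A B : algType K).
Definition rmul (b : B) : {linear tens A B -> tens A B} :=
  tmap idfun (linear_of (@mulr_is_linear K B b)).
Lemma rmulE b (c : A) (d : B) : rmul b (c ⊗ d) = c ⊗ (d * b).
Proof. by rewrite /rmul /= tmapE. Qed.
Lemma lmul_rmul b c (t : tens A B) : lmul B b (rmul c t) = rmul c (lmul B b t).
Proof.
elim/tens_ind: t => [|a u w t IH]; first by rewrite !linear0.
by rewrite !linearP IH /= !(lmulE, rmulE).
Qed.
(** Together with [tmap_tmull], this evaluates the right-hand sides of the two
    multiplicativity conditions on sigma. *)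
Lemma tmap_tmulr (t : tens A B) c :
  tmap idfun (tmul B) (tassoc (t ⊗ c)) = rmul c t.
Proof.
elim/tens_ind: t => [|a u w t IH].
  by rewrite linear0 -[_ ⊗ c]/(linear_of (@tpure_linearl _ _ _ c) 0) !linear0.
by rewrite tpure_linearl !linearP /= IH tassocE tmapE /= tmulE rmulE.
Qed.
Lemma tmap_tmull (t : tens A B) c :
  tmap (tmul A) idfun (tassocV (c ⊗ t)) = lmul B c t.
Proof.
elim/tens_ind: t => [|a u w t IH].
  by rewrite linear0 -[c ⊗ _]/(linear_of (@tpure_linearr _ _ _ c) 0) !linear0.
by rewrite tpure_linearr !linearP /= IH tassocVE tmapE /= tmulE lmulE.
Qed.
End RightMultiplication.

(** * The permutation map on tensor algebras *)

Section Twist.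
Variables (K : fieldType) (V W : vectType K) (N : nat) (q : K).
Variables (x : N.-tuple V) (y : N.-tuple W) (P : coefs K N).
Hypotheses (hx : basis_of fullv x) (hy : basis_of fullv y).
Local Notation TV := (talg V).
Local Notation TW := (talg W).
Local Notation TVW := (tens TV TW).
Local Notation gx i := (tvar (tnth x i) : TV).
Local Notation gy i := (tvar (tnth y i) : TW).

(** The second form of the permutation relations applied to s: if F j is x^j
    acting on s, this is x^l acting on the product of x_k and s. *)
Definition perm_step (k l : 'I_N) (F : 'I_N -> TVW) (s : TVW) : TVW :=
  q^-1 *: (\sum_i \sum_j P j k i l *: lmul TW (gx i) (F j)) + Bmat P k l *: s.

Lemma eq_perm_step k l F F' s : (forall j, F j = F' j) ->
  perm_step k l F s = perm_step k l F' s.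
Proof.
move=> E; congr (_ *: _ + _).
by apply: eq_bigr => i _; apply: eq_bigr => j _; rewrite E.
Qed.

Lemma perm_step_linear k l a F F' s s' :
  perm_step k l (fun j => a *: F j + F' j) (a *: s + s') =
  a *: perm_step k l F s + perm_step k l F' s'.
Proof.
rewrite /perm_step !scalerDr [RHS]addrACA; congr (_ + _); last first.
  by rewrite !scalerA mulrC.
rewrite scalerA mulrC -scalerA -scalerDr; congr (_ *: _).
rewrite scaler_sumr -big_split; apply: eq_bigr => i _ /=.
rewrite scaler_sumr -big_split; apply: eq_bigr => j _ /=.
by rewrite linearP scalerDr !scalerA mulrC.
Qed.

(** Moving x^l past one letter x_k involves all the x^j, so the recursion on
    T(V) computes the whole family Y_l (b ⊗ a) together with b ⊗ a itself. *)
Lemma reorder_exists : exists Y : 'I_N -> {linear TVW -> TVW},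
  (forall l a, Y l (1 ⊗ a) = 1 ⊗ (gy l * a)) /\
  (forall l k s, Y l (lmul TW (gx k) s) = perm_step k l (Y^~ s) s).
Proof.
(* The first component of the value on b ⊗ a is the family of all Y_l (b ⊗ a),
   the second is b ⊗ a. *)
pose X : lmodType K := ({ffun 'I_N -> TVW} * TVW)%type.
pose d k (z : X) : X :=
  ([ffun l => perm_step k l z.1 z.2], lmul TW (gx k) z.2).
have dL k : linear (d k).
  move=> a u v; apply: injective_projections => /=; last exact: linearP.
  apply/ffunP => l; rewrite !ffunE -perm_step_linear.
  by apply: eq_perm_step => j; rewrite !ffunE.
have [A [AB A1 AS]] := talg_basis_action hx (fun k => linear_of (dL k)).
pose z0 (a : TW) : X := ([ffun l => 1 ⊗ (gy l * a)], 1 ⊗ a).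
have z0L : linear z0.
  move=> a u v; apply: injective_projections => /=; last exact: tpure_linearr.
  by apply/ffunP => l; rewrite !ffunE mulrDr -scalerAr tpure_linearr.
have A2 b a : (A b (z0 a)).2 = b ⊗ a.
  elim/(talg_basis_ind hx): b => [|c s t IHs IHt|k t IH].
  - by rewrite A1.
  - by rewrite (bilinL AB) /= IHs IHt tpure_linearl.
  - by rewrite AS /= IH lmulE.
have YB l : bilin (fun b a => (A b (z0 a)).1 l).
  split=> [a c s t|b c s t]; first by rewrite (bilinL AB) /= !ffunE.
  by rewrite z0L (bilinR AB) /= !ffunE.
exists (fun l => tlift (YB l)); split=> [l a|l k s].
  by rewrite /= tliftE A1 ffunE.
elim/tens_ind: s => [|c b a s IH].
  rewrite !linear0 /perm_step scaler0 addr0 big1 ?scaler0 // => i _.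
  by rewrite big1 // => j _; rewrite !linear0.
rewrite !linearP IH -(eq_perm_step _ _ _ (fun j => esym (linearP _ _ _ _))).
rewrite perm_step_linear; congr (_ *: _ + _).
rewrite lmulE /= tliftE AS /= ffunE A2; apply: eq_perm_step => j.
by rewrite tliftE.
Qed.

Variables (Y : 'I_N -> {linear TVW -> TVW}) (A : TW -> TVW -> TVW).
Hypothesis Y1 : forall l a, Y l (1 ⊗ a) = 1 ⊗ (gy l * a).
Hypothesis YX :
  forall l k s, Y l (lmul TW (gx k) s) = perm_step k l (Y^~ s) s.
Hypothesis AB : bilin A.
Hypothesis A1 : forall s, A 1 s = s.
Hypothesis AS : forall l a s, A (gy l * a) s = Y l (A a s).

Lemma action0 a : A a 0 = 0.
Proof. by rewrite -[LHS]/(linear_of (bilinR AB a) 0) linear0. Qed.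

Lemma action_mul a b s : A (a * b) s = A a (A b s).
Proof.
elim/(talg_basis_ind hy): a => [|c a a' IH IH'|l a IH].
- by rewrite mul1r A1.
- by rewrite mulrDl -scalerAl !(bilinL AB) IH IH'.
- by rewrite -mulrA !AS IH.
Qed.

Lemma action_one a b : A a (1 ⊗ b) = 1 ⊗ (a * b).
Proof.
elim/(talg_basis_ind hy): a => [|c a a' IH IH'|l a IH].
- by rewrite mul1r A1.
- by rewrite mulrDl -scalerAl !(bilinL AB) IH IH' tpure_linearr.
- by rewrite AS IH Y1 mulrA.
Qed.

Lemma perm_step_map (f : {linear TVW -> TVW}) k l F s :
  (forall i t, f (lmul TW (gx i) t) = lmul TW (gx i) (f t)) ->
  f (perm_step k l F s) = perm_step k l (fun j => f (F j)) (f s).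
Proof.
move=> fX; rewrite linearD !linearZ linear_sum2; congr (_ *: _ + _).
by apply: eq_bigr => i _; apply: eq_bigr => j _; rewrite fX.
Qed.

(** Y is determined by its values on the words 1 ⊗ a and by its rule for passing
    through x_k, so a T(V)-linear map that commutes with Y on those words
    commutes with Y everywhere. *)
Lemma Y_comm (f : {linear TVW -> TVW}) :
  (forall i t, f (lmul TW (gx i) t) = lmul TW (gx i) (f t)) ->
  (forall l a, f (Y l (1 ⊗ a)) = Y l (f (1 ⊗ a))) ->
  forall l s, f (Y l s) = Y l (f s).
Proof.
move=> fX f1 l s; elim/tens_ind: s l => [|c b a s IH] l.
  by rewrite !linear0.
rewrite !linearP IH; congr (_ *: _ + _).
elim/(talg_basis_ind hx): b l => [|e b b' IHb IHb'|k b IHb] l; first exact: f1.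
  by rewrite tpure_linearl !linearP IHb IHb'.
rewrite -lmulE YX (perm_step_map _ _ _ _ fX) fX YX.
by apply: eq_perm_step => j; rewrite IHb.
Qed.

Lemma Y_rmul c l s : Y l (rmul TV c s) = rmul TV c (Y l s).
Proof.
symmetry; apply: Y_comm => [i t|{}l a]; first by rewrite lmul_rmul.
by rewrite Y1 !rmulE Y1 mulrA.
Qed.

Lemma action_rmul c a s : A a (rmul TV c s) = rmul TV c (A a s).
Proof.
elim/(talg_basis_ind hy): a => [|e a a' IH IH'|l a IH].
- by rewrite !A1.
- by rewrite !(bilinL AB) IH IH' linearP.
- by rewrite !AS IH Y_rmul.
Qed.

Variable twist : {linear tens TW TV -> TVW}.
Hypothesis twistE : forall a b, twist (a ⊗ b) = A a (b ⊗ 1).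

Lemma twist_gen l k : twist (gy l ⊗ gx k) =
  q^-1 *: (\sum_i \sum_j P j k i l *: (gx i ⊗ gy j)) + Bmat P k l *: (1 ⊗ 1).
Proof.
rewrite twistE -[gy l]mulr1 AS A1 -[gx k]mulr1 -lmulE YX.
congr (_ *: _ + _); apply: eq_bigr => i _; apply: eq_bigr => j _.
by rewrite Y1 lmulE !mulr1.
Qed.

(** The elements of T(W) act, and this action commutes with right
    multiplication by T(W). *)
Lemma twist_mull (t : tens (tens TW TW) TV) :
  twist (tmap (tmul TW) idfun t) = tmap idfun (tmul TW)
    (tassoc (tmap twist idfun (tassocV (tmap idfun twist (tassoc t))))).
Proof.
elim/tens_ind: t => [|c t b s IH]; first by rewrite !linear0.
rewrite !linearP IH /=; congr (_ *: _ + _).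
elim/tens_ind: t => [|{}c a a' t {}IH].
  by rewrite -[0 ⊗ b]/(linear_of (@tpure_linearl _ _ _ b) 0) !linear0.
rewrite tpure_linearl !linearP IH /=; congr (_ *: _ + _).
rewrite tassocE !tmapE /= tmulE !twistE action_mul.
elim/tens_ind: (A a' _) => [|{}c b' a'' {}s {}IH].
  by rewrite action0 -[a ⊗ 0]/(linear_of (@tpure_linearr _ _ _ a) 0) !linear0.
rewrite (bilinR AB) tpure_linearr !linearP IH /=; congr (_ *: _ + _).
by rewrite tassocVE tmapE tmap_tmulr twistE -action_rmul rmulE mul1r.
Qed.

(** For fixed b', the map that sends b1 ⊗ a1 to b1 sigma (a1 ⊗ b') commutes
    with the action of T(W), and at b ⊗ 1 its value is b b' ⊗ 1. *)
Lemma twist_mulr (t : tens TW (tens TV TV)) :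
  twist (tmap idfun (tmul TV) t) = tmap (tmul TV) idfun
    (tassocV (tmap idfun twist (tassoc (tmap twist idfun (tassocV t))))).
Proof.
elim/tens_ind: t => [|c a t s IH]; first by rewrite !linear0.
rewrite !linearP IH /=; congr (_ *: _ + _).
elim/tens_ind: t => [|{}c b b' t {}IH].
  by rewrite -[a ⊗ 0]/(linear_of (@tpure_linearr _ _ _ a) 0) !linear0.
rewrite tpure_linearr !linearP IH /=; congr (_ *: _ + _).
rewrite tassocVE !tmapE /= tmulE !twistE.
pose G : {linear TVW -> TVW} := tmap (tmul TV) idfun \o @tassocV K TV TV TW \o
  tmap idfun twist \o @tassoc K TV TW TV \o linear_of (@tpure_linearl _ _ _ b').
have GE b1 a1 : G (b1 ⊗ a1) = lmul TW b1 (A a1 (b' ⊗ 1)).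
  by rewrite /= tassocE tmapE tmap_tmull twistE.
rewrite -[RHS]/(G _).
have GX b1 u : G (lmul TW b1 u) = lmul TW b1 (G u).
  elim/tens_ind: u => [|{}c b2 a1 u {}IH]; first by rewrite !linear0.
  by rewrite !linearP lmulE GE lmulM IH -GE.
have GY l u : G (Y l u) = Y l (G u).
  by apply: Y_comm => // {}l a1; rewrite Y1 !GE !lmul1 AS.
elim/(talg_basis_ind hy): a {s IH} => [|{}c a a' IHa IHa'|l a IHa].
- by rewrite !A1 GE A1 lmulE.
- by rewrite !(bilinL AB) linearP IHa IHa'.
- by rewrite !AS GY IHa.
Qed.
End Twist.

(** * Uniqueness and descent to the quotients *)

Section Compatibility.
Variables (K : fieldType) (V : vectType K) (N : nat) (q : K).
Variables (x : N.-tuple V) (xd : N.-tuple (vdual V)) (M P : coefs K N).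
Hypotheses (hx : basis_of fullv x) (hxd : basis_of fullv xd).
Local Notation TV := (talg V).
Local Notation TW := (talg (vdual V)).
Local Notation TVW := (tens TV TW).
Local Notation gx i := (tvar (tnth x i) : TV).
Local Notation gy i := (tvar (tnth xd i) : TW).

(** The condition on products in T(V) propagates the values on pairs of
    generators to x^l ⊗ b for all words b, and then the condition on products in
    T(W) propagates them to a ⊗ b for all words a. *)
Lemma perm_extension_unique (s t : {linear tens TW TV -> TVW}) :
  perm_extension q x xd P s -> perm_extension q x xd P t -> s =1 t.
Proof.
move=> [s1 sA sB s1l s1r] [t1 tA tB t1l t1r].
have gen l b : s (gy l ⊗ b) = t (gy l ⊗ b).
  elim/(talg_basis_ind hx): b l => [|c b b' IH IH'|k b IH] l.
  - by rewrite s1r t1r.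
  - by rewrite tpure_linearr !linearP IH IH'.
  (* Both sides are images, under the same T(V)-linear evaluation, of the value
     on x^l ⊗ x_k prescribed by the permutation relations. *)
  have := sB (gy l ⊗ (gx k ⊗ b)); have := tB (gy l ⊗ (gx k ⊗ b)).
  rewrite !tassocVE !tmapE /= tmulE s1 t1 => -> ->.
  pose ev (r : {linear tens TW TV -> TVW}) : {linear TVW -> TVW} :=
    tmap (tmul TV) idfun \o @tassocV K TV TV TW \o tmap idfun r \o
    @tassoc K TV TW TV \o linear_of (@tpure_linearl _ _ _ b).
  have evE r b1 a1 : ev r (b1 ⊗ a1) = lmul TW b1 (r (a1 ⊗ b)).
    by rewrite /= tassocE tmapE tmap_tmull.
  rewrite -[LHS]/(ev s _) -[RHS]/(ev t _) !linearD !linearZ !linear_sum2 !evE.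
  rewrite s1l t1l; congr (_ *: _ + _).
  by apply: eq_bigr => i _; apply: eq_bigr => j _; rewrite !evE IH.
elim/tens_ind => [|c a b u IH]; first by rewrite !linear0.
rewrite !linearP IH; congr (_ *: _ + _) => {c u IH}.
elim/(talg_basis_ind hxd): a b => [|c a a' IH IH'|l a IH] b.
- by rewrite s1l t1l.
- by rewrite tpure_linearl !linearP IH IH'.
have := sA (gy l ⊗ a ⊗ b); have := tA (gy l ⊗ a ⊗ b).
rewrite !tassocE !tmapE /= tmulE IH => -> ->.
elim/tens_ind: (t _) => [|c b' a' u {}IH].
  by rewrite -[gy l ⊗ 0]/(linear_of (@tpure_linearr _ _ _ (gy l)) 0) !linear0.
rewrite tpure_linearr !linearP /= IH; congr (_ *: _ + _).
by rewrite !tassocVE !tmapE gen.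
Qed.

Let JV := symR_rel q x M.
Let JW := symR_dual_rel q xd M.

(** These tensors span the kernel of the projection of T(V) ⊗ T(W) onto
    Sym_R(V) ⊗ Sym_R(W). *)
Definition kernel_gen (t : TVW) : Prop :=
  (exists b a, sandwich JV b /\ t = b ⊗ a) \/
  (exists b a, sandwich JW a /\ t = b ⊗ a).
Local Notation S := (span_of kernel_gen).

Hypotheses (q0 : q != 0) (MB : braid_coefs M) (MH : hecke_coefs q M).
Hypothesis MP : skew_inverse M P.
Variables (Y : 'I_N -> {linear TVW -> TVW}) (A : TW -> TVW -> TVW).
Hypothesis Y1 : forall l a, Y l (1 ⊗ a) = 1 ⊗ (gy l * a).
Hypothesis YX :
  forall l k s, Y l (lmul TW (gx k) s) = perm_step q x P k l (Y^~ s) s.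
Hypothesis AB : bilin A.
Hypothesis A1 : forall s, A 1 s = s.
Hypothesis AS : forall l a s, A (gy l * a) s = Y l (A a s).

Lemma Y_contr i j s : contr M (fun a b => Y a (lmul TW (gx b) s)) i j =
  q^-1 *: lmul TW (gx i) (Y j s) + (i == j)%:R *: s.
Proof.
have [_] := contr_eq_uncontr MP (fun a b => Y a (lmul TW (gx b) s))
  (fun i j => q^-1 *: lmul TW (gx i) (Y j s) + (i == j)%:R *: s); apply=> a b.
by rewrite YX -uncontr_unit.
Qed.

Definition relV i j : TV := qminus q (coefs_tr M) (fun k l => gx k * gx l) i j.
Definition relW i j : TW := qminus q M (fun k l => gy l * gy k) i j.

Lemma lmul_sandwich b s : sandwich JV b -> lmul TW b s \in S.
Proof.
move=> [u [r [v [Jr ->]]]]; elim/tens_ind: s => [|c b' a s IH].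
  by rewrite linear0 rpred0.
rewrite linearP rpredD // rpredZ // lmulE; apply: span_of_gen; left.
by exists (u * r * v * b'), a; split=> //; exists u, r, (v * b'); rewrite mulrA.
Qed.

Lemma S_lmul b s : s \in S -> lmul TW b s \in S.
Proof.
apply: span_of_map => _ [] [c] [a] [J ->]; rewrite lmulE; apply: span_of_gen.
  left; exists (b * c), a; split=> //; case: J => u [r [v [Jr ->]]].
  by exists (b * u), r, v; rewrite !mulrA.
by right; exists (b * c), a.
Qed.

(** By the exchange rule, the contracted family consists of multiples of a
    relation times Y s. *)
Lemma Y_relV l i j s : Y l (lmul TW (relV i j) s) \in S.
Proof.
have E t u v : lmul TW (relV u v) t =
    qminus q (coefs_tr M) (fun k l => lmul TW (gx k) (lmul TW (gx l) t)) u v.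
  rewrite -[lmul _ _ _]/(linear_of (@lmul_linearl _ _ TW t) _) qminus_linear.
  rewrite /qminus /= lmulM; congr (_ - _).
  by apply: eq_bigr => k _; apply: eq_bigr => m _; rewrite lmulM.
have := contr2_mem (S := S) (G := fun b a c => Y c (lmul TW (relV b a) s))
  (skew_inverse_tr MP); apply=> n u v.
have := qminus_YXX (X := fun k => lmul TW (gx k)) q0 MB MH Y_contr s n u v.
rewrite -E => H.
rewrite (_ : contr2 _ _ _ _ _ = q^-1 ^+ 2 *: lmul TW (relV u v) (Y n s)).
  apply: rpredZ; apply: lmul_sandwich.
  by exists 1, (relV u v), 1; rewrite mul1r mulr1; split=> //; exists u, v.
rewrite -H; apply: eq_contr => a b; apply: eq_contr => c d.
by rewrite E qminus_linear.
Qed.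

Lemma Y_lmul_stable s : s \in S -> (forall l, Y l s \in S) ->
  forall b l, Y l (lmul TW b s) \in S.
Proof.
move=> Ss YS b; elim/(talg_basis_ind hx): b => [l|c b b' IH IH' l|k b IH l].
- by rewrite lmul1.
- by rewrite lmul_linearl linearP rpredD // rpredZ.
rewrite lmulM YX rpredD //; last by rewrite rpredZ ?S_lmul.
rewrite rpredZ // rpred_sum // => i _; rewrite rpred_sum // => j _.
by rewrite rpredZ // S_lmul.
Qed.

(** A generator u r v ⊗ a is u acting on r (v ⊗ a), and the exchange rule covers
    Y on the latter; a generator b ⊗ a is b acting on 1 ⊗ a, where Y only
    multiplies a on the left. *)
Lemma Y_stable l s : s \in S -> Y l s \in S.
Proof.
apply: span_of_map => t [] [b] [a] [].
  move=> [u [_ [v [[i [j ->]] ->]]]] ->.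
  rewrite -/(relV i j) -mulrA -lmulE -lmulE; apply: Y_lmul_stable => [|{}l].
    apply: lmul_sandwich; exists 1, (relV i j), 1.
    by rewrite mul1r mulr1; split=> //; exists i, j.
  exact: Y_relV.
move=> [u [r [v [Jr ->]]]] ->; rewrite -[b]mulr1 -lmulE.
apply: Y_lmul_stable => [|{}l]; last rewrite Y1; apply: span_of_gen; right.
  by exists 1, (u * r * v); split=> //; exists u, r, v.
exists 1, (gy l * (u * r * v)); split=> //.
by exists (gy l * u), r, v; rewrite !mulrA.
Qed.

Lemma action_stable a s : s \in S -> A a s \in S.
Proof.
move=> Ss; elim/(talg_basis_ind hxd): a => [|c a a' IH IH'|l a IH].
- by rewrite A1.
- by rewrite (bilinL AB) rpredD // rpredZ.
- by rewrite AS Y_stable.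
Qed.

(** By induction on the word in T(V): on 1 ⊗ a a relation multiplies a, and the
    exchange rule moves it past each x_k. *)
Lemma action_relW i j s : A (relW i j) s \in S.
Proof.
have E t u v : A (relW u v) t = qminus q M (fun k l => Y l (Y k t)) u v.
  rewrite -[LHS]/(linear_of (bilinL AB t) _) qminus_linear /= /qminus.
  have AA k l : A (gy l * gy k) t = Y l (Y k t).
    by rewrite AS -[gy k]mulr1 AS A1.
  by rewrite AA; congr (_ - _); apply: eq_bigr => k _; apply: eq_bigr => l _;
    rewrite AA.
elim/tens_ind: s i j => [|c b a s IH] i j.
  by rewrite (action0 AB) rpred0.
rewrite (bilinR AB) rpredD // rpredZ // => {c s IH}.
elim/(talg_basis_ind hx): b i j => [|c b b' IH IH'|k b IH] i j.
- rewrite (action_one hxd Y1 AB A1 AS); apply: span_of_gen; right.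
  exists 1, (relW i j * a); split=> //; exists 1, (relW i j), a.
  by rewrite mul1r; split=> //; exists i, j.
- by rewrite tpure_linearl (bilinR AB) rpredD // rpredZ.
rewrite -lmulE.
have := contr2_mem (S := S)
  (G := fun b' a' c => A (relW b' a') (lmul TW (gx c) (b ⊗ a))) MP.
apply=> n u v.
have := qminus_YYX (X := fun k => lmul TW (gx k)) q0 MB MH Y_contr
  (b ⊗ a) n u v.
rewrite -qminus_linear -E => H.
rewrite (_ : contr2 _ _ _ _ _ =
  q^-1 ^+ 2 *: lmul TW (gx n) (A (relW u v) (b ⊗ a))).
  by rewrite rpredZ // S_lmul.
by rewrite -H; apply: eq_contr => a' b'; apply: eq_contr => c d; rewrite E.
Qed.

Lemma action_sandwich a s : sandwich JW a -> A a s \in S.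
Proof.
move=> [u [_ [v [[i [j ->]] ->]]]].
rewrite !(action_mul hxd AB A1 AS); apply: action_stable; exact: action_relW.
Qed.

Let proj : {linear TVW -> tens (symR q x M) (symR_dual q xd M)} :=
  tmap (qproj JV) (qproj JW).

Lemma proj_kernel t : t \in S -> proj t = 0.
Proof.
move/span_ofP/(_ (fun t => proj t = 0)); apply.
  split=> [|a u v Su Sv]; first exact: linear0.
  by rewrite linearP Su Sv scaler0 addr0.
have q0' (U : lmodType K) (J : U -> Prop) u : J u -> projm J u = 0.
  move=> Ju; rewrite -(linear0 (projm J)); apply/projm_eq; rewrite subr0.
  exact: span_of_gen.
move=> _ [] [b] [a] [J ->]; rewrite /proj /= tmapE /=.
  rewrite (q0' _ _ _ J) -[LHS]/(linear_of (@tpure_linearl _ _ _ _) 0).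
  by rewrite linear0.
rewrite (q0' _ _ _ J) -[LHS]/(linear_of (@tpure_linearr _ _ _ _) 0).
by rewrite linear0.
Qed.

Variable twist : {linear tens TW TV -> TVW}.
Hypothesis twistE : forall a b, twist (a ⊗ b) = A a (b ⊗ 1).

Lemma twist_perm_extension : perm_extension q x xd P twist.
Proof.
split.
- move=> k l; exact: (twist_gen Y1 YX A1 AS twistE).
- exact: (twist_mull hx hxd Y1 YX AB A1 AS twistE).
- exact: (twist_mulr hx hxd Y1 YX AB A1 AS twistE).
- by move=> b; rewrite twistE A1.
- by move=> a; rewrite twistE (action_one hxd Y1 AB A1 AS) mulr1.
Qed.

(** Well-definedness of the induced map: modulo the kernel of the projection,
    sigma depends only on the classes of both arguments. *)
Lemma twist_ideal a a' b b' :
  a - a' \in span_of (sandwich JW) -> b - b' \in span_of (sandwich JV) ->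
  proj (twist (a ⊗ b)) = proj (twist (a' ⊗ b')).
Proof.
move=> aI bI.
pose tl c := linear_of (@tpure_linearl K TW TV c).
pose tr c := linear_of (@tpure_linearr K TW TV c).
have IW u c : u \in span_of (sandwich JW) -> twist (u ⊗ c) \in S.
  apply: (span_of_map (f := twist \o tl c)) => r Jr.
  by rewrite /= twistE; apply: action_sandwich.
have IV u c : u \in span_of (sandwich JV) -> twist (c ⊗ u) \in S.
  apply: (span_of_map (f := twist \o tr c)) => r Jr.
  rewrite /= twistE; apply: action_stable; rewrite -[r]mulr1 -lmulE.
  exact: lmul_sandwich.
transitivity (proj (twist (a' ⊗ b))); apply/subr0_eq; rewrite -!linearB.
  by rewrite -[_ - _]/(tl b a - tl b a') -linearB proj_kernel // IW.
by rewrite -[_ - _]/(tr a' b - tr a' b') -linearB proj_kernel // IV.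
Qed.

Lemma twist_descends : descends q x xd M twist.
Proof.
pose f (a : symR_dual q xd M) (b : symR q x M) :=
  proj (twist (reprm a ⊗ reprm b)).
have E a b : f (qproj JW a) (qproj JV b) = proj (twist (a ⊗ b)).
  by apply: twist_ideal; apply/projm_eq; exact: projm_surj.
have fB : bilin f.
  split=> [b|a] c s t.
    rewrite -[b]qproj_surj -[s]qproj_surj -[t]qproj_surj -linearP !E.
    by rewrite tpure_linearl !linearP.
  rewrite -[a]qproj_surj -[s]qproj_surj -[t]qproj_surj -linearP !E.
  by rewrite tpure_linearr !linearP.
exists (tlift fB); elim/tens_ind => [|c a b t IH]; first by rewrite !linear0.
rewrite !linearP IH; congr (_ *: _ + _).
by rewrite /= tmapE /= tliftE E.
Qed.
End Compatibility.

Lemma compatible_of_hecke (K : fieldType) (V : vectType K) (N : nat) (q : K)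
    (x : N.-tuple V) (xd : N.-tuple (vdual V)) (M P : coefs K N) :
  basis_of fullv x -> basis_of fullv xd -> q != 0 ->
  braid_coefs M -> hecke_coefs q M -> skew_inverse M P ->
  compatible q x xd M P.
Proof.
move=> hx hxd q0 MB MH MP.
have [Y [Y1 YX]] := reorder_exists q xd P hx.
have [A [AB A1 AS]] := talg_basis_action hxd Y.
have tB : bilin (fun a b => A a (b ⊗ 1)).
  split=> [b|a] c s t; first exact: (bilinL AB).
  by rewrite tpure_linearl (bilinR AB).
have tE a b : tlift tB (a ⊗ b) = A a (b ⊗ 1) by exact: tliftE.
have ext := twist_perm_extension hx hxd Y1 YX AB A1 AS tE.
exists (tlift tB); split=> // [t tX|].
  exact: (perm_extension_unique hx hxd tX ext).
exact: (twist_descends hx hxd q0 MB MH MP Y1 YX AB A1 AS tE).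
Qed.

Theorem proposition3 (RR : realType) (N : nat) (V : vectType RR[i])
    (x : N.-tuple V) (hx : basis_of fullv x)
    (q : RR[i]) (hq0 : q != 0) (hq1 : q != 1) (hqN1 : q != -1)
    (R : {linear tens V V -> tens V V}) (Rm : coefs RR[i] N)
    (hRm : has_matrix x R Rm) (hR : hecke_symmetry q R)
    (Psi : {linear tens V V -> tens V V}) (Psim : coefs RR[i] N)
    (hPsim : has_matrix x Psi Psim) (hPsi : skew_inverse Rm Psim)
    (pairing : {linear tens V (vdual V) -> RR[i]^o})
    (hpairing : nondegenerate_pairing pairing)
    (xd : N.-tuple (vdual V)) (hxd : right_dual_basis pairing x xd) :
  compatible q x xd Rm Psim /\
  forall (D : algType RR[i]) (X Y : 'I_N -> D),
    perm_rel_R q Rm X Y <-> perm_rel_Psi q Psim X Y.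
Proof.
split=> [|D X Y]; last exact: perm_rel_equiv.
apply: compatible_of_hecke => //.
- by case: hxd.
- by case: hR => /(has_matrix_braid hx hRm).
- exact: (has_matrix_hecke hx hRm).
Qed.
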